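(* Let $d$ be a positive integer and let $\mathcal{F}:\mathcal{P}(\mathbb{S}^{d-1})\to\mathbb{R}^{d\times d}$ be such that there is a constant $L_{\mathcal{F}}\ge 0$ with $\|\mathcal{F}[\varrho]-\mathcal{F}[\widetilde\varrho]\|_{\mathrm{op}}\le L_{\mathcal{F}}W_1(\varrho,\widetilde\varrho)$ for all $\varrho,\widetilde\varrho\in\mathcal{P}(\mathbb{S}^{d-1})$. Set $C_{\mathcal{F}}:=\sup_{\varrho\in\mathcal{P}(\mathbb{S}^{d-1})}\|\mathcal{F}[\varrho]\|_{\mathrm{op}}<\infty$ and $b(x,\varrho):=(I_d-xx^{\top})\mathcal{F}[\varrho]x$ for $x\in\mathbb{S}^{d-1}$, $\varrho\in\mathcal{P}(\mathbb{S}^{d-1})$. Then for every $\rho_0\in\mathcal{P}(\mathbb{S}^{d-1})$ there exists a unique weak solution $\rho\in C([0,\infty);\mathcal{P}(\mathbb{S}^{d-1}))$ to the mean-field equation $$\partial_t\rho+\operatorname{div}_{\mathbb{S}^{d-1}}\left(b(\cdot,\rho)\rho\right)=0,\qquad \rho(0)=\rho_0.$$ Moreover, this solution admits the characteristic representation $\rho(t)=(\Psi_t)_{\sharp}\rho_0$ for all $t\ge0$, where $\Psi_t:\mathbb{S}^{d-1}\to\mathbb{S}^{d-1}$ is the characteristic flow associated with $\rho$, determined by $$\frac{d}{dt}\Psi_t(x)=b(\Psi_t(x),\rho(t)),\qquad \Psi_0(x)=x.$$ The solution is also stable with respect to the initial data: if $\rho$ and $\widetilde\rho$ are the solutions corresponding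 to initial data $\rho_0$ and $\widetilde\rho_0$ in $\mathcal{P}(\mathbb{S}^{d-1})$, respectively, then for every $t\ge 0$, $$W_1(\rho(t),\widetilde\rho(t))\le e^{(3C_{\mathcal{F}}+L_{\mathcal{F}})t}\,W_1(\rho_0,\widetilde\rho_0).$$
   Context: $\mathbb{S}^{d-1}$ is the unit sphere in $\mathbb{R}^d$ with the Euclidean norm $\|\cdot\|$; $\|\cdot\|_{\mathrm{op}}$ is the matrix operator norm; $\mathcal{P}(\mathbb{S}^{d-1})$ is the set of (Borel) probability measures on $\mathbb{S}^{d-1}$, equipped with the Wasserstein-1 distance $W_1$ induced by the Euclidean distance (continuity of curves in $\mathcal{P}(\mathbb{S}^{d-1})$ is with respect to $W_1$). $h_\sharp\mu$ is the pushforward of $\mu$ under $h$. The finiteness of $C_{\mathcal{F}}$ follows from the Lipschitz assumption and the compactness of $(\mathcal{P}(\mathbb{S}^{d-1}),W_1)$. Weak solution: a curve $\rho\in C([0,\infty);\mathcal{P}(\mathbb{S}^{d-1}))$ is a weak solution with initial condition $\rho_0$ if $\rho(0)=\rho_0$ and, for every $\varphi\in C^1(\mathbb{S}^{d-1})$ and every $t\ge0$, $$\int_{\mathbb{S}^{d-1}}\varphi(x)\,d\rho(t,x)-\int_{\mathbb{S}^{d-1}}\varphi(x)\,d\rho_0(x)=\int_0^t\int_{\mathbb{S}^{d-1}}\nabla_{\mathbb{S}^{d-1}}\varphi(x)^{\top}b(x,\rho(s))\,d\rho(s,x)\,ds,$$ where $\nabla_{\mathbb{S}^{d-1}}$ is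 the Riemannian (spherical) gradient, viewed as a tangent vector in $\mathbb{R}^d$. *)

(* Defs.v *)
From HB Require Import structures.
From mathcomp Require Import all_boot all_order all_algebra.
From mathcomp Require Import all_classical all_reals all_analysis.
From mathcomp Require Import giry.
Set Implicit Arguments.
Unset Strict Implicit.
Unset Printing Implicit Defensive.
Import Order.TTheory GRing.Theory Num.Theory.
Import numFieldNormedType.Exports.
Local Open Scope classical_set_scope.
Local Open Scope ring_scope.

Definition dot (R : realType) (m : nat) (u v : 'cV[R]_m) : R :=
  (u^T *m v) 0 0.

(* The library norm `|x| on 'cV[R]_m is the max norm; it induces the same
   topology (hence the same limits and derivatives) as the Euclidean norm. *)
Definition enorm (R : realType) (m : nat) (x : 'cV[R]_m) : R :=
  Num.sqrt (dot x x).

Definition opnorm (R : realType) (m : nat) (A : 'M[R]_m) : R :=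
  sup [set enorm (A *m x) | x in [set x : 'cV[R]_m | enorm x <= 1]].

Definition sphere_set (R : realType) (n : nat) : set 'cV[R]_n.+1 :=
  [set x | enorm x = 1].

(* The unit sphere of R^(n+1), as a type. The dimension is a successor because
   the sphere of R^0 is empty, while measurable types are pointed. *)
Definition sphere (R : realType) (n : nat) : Type :=
  set_type (@sphere_set R n).

Definition sphere_val (R : realType) (n : nat) (x : sphere R n) :
  'cV[R]_n.+1 := set_val x.
Coercion sphere_val : sphere >-> matrix.

Section sphere_structures.
Variables (R : realType) (n : nat).

Lemma enorm_e0 : enorm (delta_mx 0 0 : 'cV[R]_n.+1) = 1.
Proof.
by rewrite /enorm /dot trmx_delta mul_delta_mx mxE !eqxx sqrtr1.
Qed.

Definition sphere_point : sphere R n :=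
  exist _ (delta_mx 0 0) (mem_set enorm_e0).

HB.instance Definition _ := Choice.copy (sphere R n) (set_type (@sphere_set R n)).
HB.instance Definition _ :=
  PseudoMetric.copy (sphere R n) (set_type (@sphere_set R n)).
HB.instance Definition _ := isPointed.Build (sphere R n) sphere_point.

HB.instance Definition _ :=
  @isMeasurable.Build (sigma_display (@open (sphere R n))) (sphere R n)
    <<s @open (sphere R n) >> (@sigma_algebra0 _ setT _)
    (@sigma_algebraC _ _) (@sigma_algebra_bigcup _ setT _).

End sphere_structures.

Notation Psphere R n := (probability (sphere R n) R).

Definition coupling (R : realType) (n : nat) (mu nu : Psphere R n)
    (pi : probability (sphere R n * sphere R n)%type R) : Prop :=
  forall A : set (sphere R n), measurable A ->
    pi (fst @^-1` A) = mu A /\ pi (snd @^-1` A) = nu A.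

Definition W1 (R : realType) (n : nat) (mu nu : Psphere R n) : \bar R :=
  ereal_inf [set (\int[pi]_z (enorm (sphere_val z.1 - sphere_val z.2))%:E)%E
            | pi in coupling mu nu].

Section mean_field.
Variables (R : realType) (n : nat).
Variable F : Psphere R n -> 'M[R]_n.+1.

Definition CF : R := sup (range (fun mu => opnorm (F mu))).

Definition drift (x : sphere R n) (mu : Psphere R n) : 'cV[R]_n.+1 :=
  (1%:M - (x : 'cV_n.+1) *m (x : 'cV_n.+1)^T) *m F mu *m x.

(* g is the Riemannian gradient of phi at x: the tangent vector at x such that
   d phi_x(v) = <g, v>, the differential being computed along curves on the
   sphere passing through x with velocity v. *)
Definition is_sgrad (phi : sphere R n -> R) (x : sphere R n)
    (g : 'cV[R]_n.+1) : Prop :=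
  dot x g = 0 /\
  forall (c : R -> sphere R n) (v : 'cV[R]_n.+1),
    c 0 = x -> is_derive (0 : R) (1 : R) (fun s => sphere_val (c s)) v ->
    is_derive (0 : R) (1 : R) (fun s => phi (c s)) (dot g v).

(* phi is of class C^1 on the sphere, with spherical gradient G; G is determined
   by phi, since every tangent vector is the velocity of some curve. *)
Definition C1_sgrad (phi : sphere R n -> R) (G : sphere R n -> 'cV[R]_n.+1) :
    Prop :=
  [/\ continuous phi, continuous G & forall x, is_sgrad phi x (G x)].

(* Curves on [0, +oo[ are functions on R whose values at negative times are
   never used. Two measures may differ, as functions, on non-measurable sets,
   so equality of measures is measure_eq. *)
Definition W1_continuous (rho : R -> Psphere R n) : Prop :=
  forall t : R, 0 <= t ->
    W1 (rho s) (rho t) @[s --> within [set s : R | 0 <= s] (nbhs t)]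
      --> (0 : \bar R)%E.

Definition weak_solution (rho0 : Psphere R n) (rho : R -> Psphere R n) : Prop :=
  [/\ W1_continuous rho, measure_eq (rho 0) rho0 &
   forall (phi : sphere R n -> R) (G : sphere R n -> 'cV[R]_n.+1),
     C1_sgrad phi G -> forall t : R, 0 <= t ->
     \int[rho t]_x phi x - \int[rho0]_x phi x =
     \int[lebesgue_measure]_(s in `[0, t])
        (\int[rho s]_x dot (G x) (drift x (rho s)))].

(* The derivative is taken within [0, +oo[, hence one-sided at time 0. *)
Definition char_flow (rho : R -> Psphere R n)
    (Psi : R -> sphere R n -> sphere R n) : Prop :=
  forall x : sphere R n, Psi 0 x = x /\
    forall t : R, 0 <= t ->
      (s - t)^-1 *: (sphere_val (Psi s x) - sphere_val (Psi t x))
        @[s --> within [set s : R | 0 <= s] t^']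
        --> drift (Psi t x) (rho t).

End mean_field.

(* Main.v *)
Require Import Defs.
From HB Require Import structures.
From mathcomp Require Import all_boot all_order all_algebra.
From mathcomp Require Import all_classical all_reals all_analysis.
From mathcomp Require Import giry measurable_realfun.
From mathcomp Require Import ring lra.
Set Implicit Arguments.
Unset Strict Implicit.
Unset Printing Implicit Defensive.
Import Order.TTheory GRing.Theory Num.Theory.
Import numFieldNormedType.Exports.
Local Open Scope classical_set_scope.
Local Open Scope ring_scope.

(* The drift (I - x x^T) F[rho] x is the velocity induced on directions by the
   linear equation y' = M(t) y with M(t) = F[rho(t)], so the characteristic flow
   is Psi_t x = Phi_t x / |Phi_t x|, where Phi' = M Phi and Phi_0 = 1.

   Representation: let rho be any weak solution and B_t the inverse of Phi_t,
   so that B' = - B M. For a C^1 function f, the test functions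
   u_t(x) = f(B_t x / |B_t x|) are explicit, C^1, and solve the transport
   equation dual to the continuity equation, so the integral of u_t against
   rho(t) is constant. Letting f approximate indicators of intersections of
   caps yields rho(t) = (Psi_t)_# rho_0.

   Stability: push a coupling of the initial data forward by the two flows and
   apply Gronwall's inequality to the resulting transport cost; uniqueness is
   the case W1 = 0.

   Existence: the map sending M to t |-> F[(Psi^M_t)_# rho_0] is a contraction
   for the norm sup_t e^(-lam t) |M(t)| when lam is large. *)

(** * Euclidean and operator norms *)

(** Uniqueness calls for test functions that are C^1 in x, hence for a backward flow differentiable
    in its starting point; through the matrices B_t this becomes linear algebra. The weak
    formulation only admits test functions frozen in time, so the increment of the integral of u_t
    is split into a change of measure and a change of function, whose first-order terms cancel in
    the limit. Such limits are first-order expansions uniform in x, provided by compactness of the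
    sphere; a single Gronwall lemma for right Dini derivatives turns them into estimates, and with
    rate 0 into identities.

    The constant 3C has one C from the linear field and two from the quadratic dependence of x x^T
    on x. The coefficient L enters because the transport cost of the pair of flows itself bounds W1
    at each time. This is done for every coupling, and the infimum is taken last.

    The contraction runs over curves of matrices, where limits are entrywise limits of real numbers;
    the measures are recovered as pushforwards of rho_0. *)

Section Euclid.
Variables (R : realType) (m : nat).
Implicit Types (u v w x y : 'cV[R]_m) (A : 'M[R]_m) (c : R).

Lemma dotE u v : dot u v = \sum_i u i 0 * v i 0.
Proof. by rewrite /dot mxE; apply: eq_bigr => i _; rewrite mxE. Qed.

Lemma dotC u v : dot u v = dot v u.
Proof. by rewrite !dotE; apply: eq_bigr => i _; rewrite mulrC. Qed.

Lemma dotDl u v w : dot (u + v) w = dot u w + dot v w.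
Proof. by rewrite /dot linearD mulmxDl mxE. Qed.

Lemma dotZl c u v : dot (c *: u) v = c * dot u v.
Proof. by rewrite /dot linearZ -scalemxAl mxE. Qed.

Lemma dotNl u v : dot (- u) v = - dot u v.
Proof. by rewrite -scaleN1r dotZl mulN1r. Qed.

Lemma dotDr u v w : dot w (u + v) = dot w u + dot w v.
Proof. by rewrite dotC dotDl !(dotC w). Qed.

Lemma dotZr c u v : dot u (c *: v) = c * dot u v.
Proof. by rewrite dotC dotZl dotC. Qed.

Lemma dotNr u v : dot u (- v) = - dot u v.
Proof. by rewrite dotC dotNl dotC. Qed.

Lemma dot0l u : dot 0 u = 0.
Proof. by rewrite -(scale0r 0) dotZl mul0r. Qed.

Definition dot_linE := (dotDl, dotDr, dotNl, dotNr, dotZl, dotZr).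

Lemma dot_trmx A u v : dot u (A *m v) = dot (A^T *m u) v.
Proof. by rewrite /dot trmx_mul trmxK mulmxA. Qed.

Lemma dot_ge0 u : 0 <= dot u u.
Proof. by rewrite dotE sumr_ge0// => i _; rewrite -expr2 sqr_ge0. Qed.

Lemma enorm_ge0 u : 0 <= enorm u.
Proof. exact: sqrtr_ge0. Qed.

Lemma enorm_sqr u : enorm u ^+ 2 = dot u u.
Proof. by rewrite sqr_sqrtr// dot_ge0. Qed.

Lemma dot_eq0 u : dot u u = 0 -> u = 0.
Proof.
rewrite dotE => /eqP; rewrite psumr_eq0 => [/allP u0|i _]; last first.
  by rewrite -expr2 sqr_ge0.
apply/colP => i; have := u0 i (mem_index_enum i).
by rewrite mxE mulf_eq0 orbb => /eqP.
Qed.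

Lemma enorm_eq0 u : (enorm u == 0) = (u == 0).
Proof.
apply/eqP/eqP => [u0|->]; first by apply: dot_eq0; rewrite -enorm_sqr u0 expr0n.
by rewrite /enorm -(scale0r 0) dotZl mul0r sqrtr0.
Qed.

Lemma enorm0 : enorm (0 : 'cV[R]_m) = 0.
Proof. by apply/eqP; rewrite enorm_eq0. Qed.

Lemma enorm_gt0 u : (0 < enorm u) = (u != 0).
Proof. by rewrite lt_neqAle enorm_ge0 andbT eq_sym enorm_eq0. Qed.

Lemma enormZ c u : enorm (c *: u) = `|c| * enorm u.
Proof.
by rewrite /enorm dotZl dotZr mulrA -expr2 sqrtrM ?sqr_ge0// sqrtr_sqr.
Qed.

Lemma enormN u : enorm (- u) = enorm u.
Proof. by rewrite -scaleN1r enormZ normrN1 mul1r. Qed.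

Lemma enormC u v : enorm (u - v) = enorm (v - u).
Proof. by rewrite -enormN opprB. Qed.

(** Cauchy-Schwarz: the square of the norm of |v| u - |u| v is 2 |u| |v| (|u| |v| - <u, v>). *)
Lemma dot_le_enorm u v : dot u v <= enorm u * enorm v.
Proof.
have [->|u0] := eqVneq u 0; first by rewrite dot0l mulr_ge0 ?enorm_ge0.
have [->|v0] := eqVneq v 0.
  by rewrite dotC dot0l mulr_ge0 ?enorm_ge0.
have := dot_ge0 (enorm v *: u - enorm u *: v).
rewrite !dot_linE -!enorm_sqr (dotC v u).
rewrite -enorm_gt0 in u0; rewrite -enorm_gt0 in v0.
have := mulr_gt0 u0 v0; nra.
Qed.

Lemma normr_dot_le u v : `|dot u v| <= enorm u * enorm v.
Proof.
rewrite ler_norml dot_le_enorm andbT lerNl -dotNl.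
by rewrite (le_trans (dot_le_enorm _ _))// enormN.
Qed.

Lemma ler_enormD u v : enorm (u + v) <= enorm u + enorm v.
Proof.
rewrite -(@ler_pXn2r _ 2) ?nnegrE ?addr_ge0 ?enorm_ge0//.
rewrite sqrrD !enorm_sqr !dot_linE (dotC v u).
have := dot_le_enorm u v; lra.
Qed.

Lemma ler_enormB u v : enorm (u - v) <= enorm u + enorm v.
Proof. by rewrite (le_trans (ler_enormD _ _))// enormN. Qed.

Lemma ler_enorm_dist u v w : enorm (u - w) <= enorm (u - v) + enorm (v - w).
Proof. by rewrite (le_trans _ (ler_enormD _ _))// subrKA. Qed.

Lemma ler_distB_enorm u v w x :
  `|enorm (u - v) - enorm (w - x)| <= enorm (u - w) + enorm (v - x).
Proof.
have h1 := ler_enorm_dist u w v; have h2 := ler_enorm_dist w x v.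
have h3 := ler_enorm_dist w u x; have h4 := ler_enorm_dist u v x.
rewrite (enormC w u) in h3; rewrite (enormC x v) in h2.
by rewrite ler_norml; apply/andP; split; lra.
Qed.

Lemma coord_le_enorm u i : `|u i 0| <= enorm u.
Proof.
rewrite -sqrtr_sqr ler_sqrt ?dot_ge0// dotE (bigD1 i)//= -expr2 lerDl.
by rewrite sumr_ge0// => j _; rewrite -expr2 sqr_ge0.
Qed.

Lemma enorm_le_sum u : enorm u <= \sum_i `|u i 0|.
Proof.
have s0 : 0 <= \sum_i `|u i 0| by rewrite sumr_ge0.
rewrite -(@ler_pXn2r _ 2) ?nnegrE ?enorm_ge0// enorm_sqr dotE.
rewrite expr2 mulr_suml ler_sum// => i _.
rewrite (le_trans (ler_norm _))// normrM ler_wpM2l//.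
by rewrite (bigD1 i)//= lerDl sumr_ge0.
Qed.

Lemma enorm_le_norm u : enorm u <= m%:R * `|u|.
Proof.
rewrite (le_trans (enorm_le_sum u))//.
rewrite (le_trans (_ : _ <= \sum_(i < m) `|u|))//; last first.
  by rewrite sumr_const card_ord mulr_natl.
apply: ler_sum => i _; rewrite [leRHS]/Num.Def.normr/= mx_normrE.
by apply: le_trans (le_bigmax _ _ (i, 0)).
Qed.

End Euclid.

Lemma coord_le_norm (R : realType) (p q : nat) (A : 'M[R]_(p, q)) i j :
  `|A i j| <= `|A|.
Proof.
rewrite [leRHS]/Num.Def.normr/= mx_normrE.
by apply: le_trans (le_bigmax _ _ (i, j)).
Qed.

Lemma norm_le_coord (R : realType) (p q : nat) (A : 'M[R]_(p, q)) (e : R) :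
  0 <= e -> (forall i j, `|A i j| <= e) -> `|A| <= e.
Proof.
move=> e0 Ae; rewrite [leLHS]/Num.Def.normr/= mx_normrE.
by apply: bigmax_le => // -[i j] _; exact: Ae.
Qed.

Section Opnorm.
Variables (R : realType) (m : nat).
Implicit Types (u v w x y : 'cV[R]_m) (A : 'M[R]_m) (c : R).

Lemma enorm_mulmx_norm A x : enorm (A *m x) <= (m%:R * m%:R * `|A|) * enorm x.
Proof.
rewrite (le_trans (enorm_le_norm _))// -!mulrA ler_wpM2l//.
apply: norm_le_coord => [|i j]; first by rewrite !mulr_ge0// enorm_ge0.
rewrite ord1 mxE (le_trans (ler_norm_sum _ _ _))//.
rewrite (le_trans (_ : _ <= \sum_(i < m) `|A| * enorm x))//; last first.
  by rewrite sumr_const card_ord mulr_natl.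
apply: ler_sum => k _; rewrite normrM ler_pM//; first exact: coord_le_norm.
exact: coord_le_enorm.
Qed.

(** [sup] is 0 on a set without supremum, so [opnorm] has its meaning only through this fact. *)
Lemma opnorm_has_sup A :
  has_sup [set enorm (A *m x) | x in [set x : 'cV[R]_m | enorm x <= 1]].
Proof.
split.
  by exists (enorm (A *m 0)); exists 0 => //=; rewrite enorm0.
exists (m%:R * m%:R * `|A|) => _ [x /= x1 <-].
by rewrite (le_trans (enorm_mulmx_norm _ _))// ler_piMr// mulr_ge0.
Qed.

Lemma opnorm_ge0 A : 0 <= opnorm A.
Proof.
rewrite -(enorm0 R m) -(mulmx0 1 A); apply: sup_upper_bound; last first.
  by exists 0 => //=; rewrite enorm0.
exact: opnorm_has_sup.
Qed.

Lemma enorm_mulmx A x : enorm (A *m x) <= opnorm A * enorm x.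
Proof.
have [->|x0] := eqVneq x 0; first by rewrite mulmx0 enorm0 mulr0.
have x0' : 0 < enorm x by rewrite enorm_gt0.
rewrite -ler_pdivrMr// mulrC.
rewrite -[X in X * _]ger0_norm ?invr_ge0 ?enorm_ge0// -enormZ -linearZ /=.
apply: sup_upper_bound; first exact: opnorm_has_sup.
exists ((enorm x)^-1 *: x) => //=.
by rewrite enormZ ger0_norm ?invr_ge0 ?enorm_ge0// mulVf// gt_eqF.
Qed.

Lemma opnorm_le A c : 0 <= c -> (forall x, enorm (A *m x) <= c * enorm x) ->
  opnorm A <= c.
Proof.
move=> c0 Ac; apply: ge_sup => [|_ [x /= x1 <-]].
  by have [] := opnorm_has_sup A.
by rewrite (le_trans (Ac x))// ler_piMr.
Qed.

Lemma norm_le_opnorm A : `|A| <= opnorm A.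
Proof.
apply: norm_le_coord => [|i j]; first exact: opnorm_ge0.
have <- : (A *m (delta_mx j 0 : 'cV_m)) i 0 = A i j.
  by rewrite -colE mxE.
rewrite (le_trans (coord_le_enorm _ _))// (le_trans (enorm_mulmx _ _))//.
by rewrite /enorm /dot trmx_delta mul_delta_mx mxE !eqxx sqrtr1 mulr1.
Qed.

End Opnorm.

(** * Limits and derivatives of matrix-valued functions *)

Section MatrixLimits.
Variable R : realType.

Lemma cvg_mxP (T : Type) (F : set_system T) {FF : Filter F} (p q : nat)
    (f : T -> 'M[R]_(p, q)) (l : 'M[R]_(p, q)) :
  f x @[x --> F] --> l <->
  forall i j, f x i j @[x --> F] --> l i j.
Proof.
split=> [fl i j|fl].
  apply/cvgrPdist_le => /= e e0; move/cvgrPdist_le : fl => /(_ e e0).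
  apply: filterS => x; apply: le_trans.
  by have := coord_le_norm (l - f x) i j; rewrite !mxE.
apply/cvgrPdist_le => /= e e0.
have : \forall x \near F, forall ij : 'I_p * 'I_q,
    `|l ij.1 ij.2 - f x ij.1 ij.2| <= e.
  apply: filter_forall => -[i j] /=.
  by move/cvgrPdist_le : (fl i j); apply.
apply: filterS => x lx; apply: norm_le_coord => [|i j]; first exact: ltW.
by rewrite !mxE; exact: (lx (i, j)).
Qed.

Lemma cvg_sumr (T : Type) (F : set_system T) {FF : Filter F} (p : nat)
    (f : 'I_p -> T -> R) (l : 'I_p -> R) :
  (forall i, f i x @[x --> F] --> l i) ->
  \sum_(i < p) f i x @[x --> F] --> \sum_(i < p) l i.
Proof. by move=> fl; apply: cvg_big => //; exact: add_continuous. Qed.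

Lemma cvg_mulmx (T : Type) (F : set_system T) {FF : Filter F} (p q r : nat)
    (f : T -> 'M[R]_(p, q)) (g : T -> 'M[R]_(q, r))
    (a : 'M[R]_(p, q)) (b : 'M[R]_(q, r)) :
  f x @[x --> F] --> a -> g x @[x --> F] --> b ->
  (f x *m g x) @[x --> F] --> a *m b.
Proof.
move=> /cvg_mxP fa /cvg_mxP gb; apply/cvg_mxP => i j.
rewrite mxE; under eq_fun do rewrite mxE.
by apply: cvg_sumr => k; apply: cvgM; [exact: fa|exact: gb].
Qed.

Lemma cvg_trmx (T : Type) (F : set_system T) {FF : Filter F} (p q : nat)
    (f : T -> 'M[R]_(p, q)) (a : 'M[R]_(p, q)) :
  f x @[x --> F] --> a -> (f x)^T @[x --> F] --> a^T.
Proof.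
move=> /cvg_mxP fa; apply/cvg_mxP => i j.
by rewrite mxE; under eq_fun do rewrite mxE; exact: fa.
Qed.

Lemma cvg_dot (T : Type) (F : set_system T) {FF : Filter F} (m : nat)
    (f g : T -> 'cV[R]_m) (a b : 'cV[R]_m) :
  f x @[x --> F] --> a -> g x @[x --> F] --> b ->
  dot (f x) (g x) @[x --> F] --> dot a b.
Proof.
move=> fa gb; rewrite /dot; apply: (cvg_mxP _ _).1.
by apply: cvg_mulmx => //; exact: cvg_trmx.
Qed.

Lemma cvg_enorm (T : Type) (F : set_system T) {FF : Filter F} (m : nat)
    (f : T -> 'cV[R]_m) (a : 'cV[R]_m) :
  f x @[x --> F] --> a -> enorm (f x) @[x --> F] --> enorm a.
Proof.
move=> fa; apply: (@cvg_comp _ _ _ (fun x => dot (f x) (f x)) Num.sqrt).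
  by apply: cvg_dot; exact: fa.
exact: sqrt_continuous.
Qed.

End MatrixLimits.

Section MatrixDerivatives.
Variable R : realType.

Lemma is_derive_mxP (p q : nat) (f : R -> 'M[R]_(p, q)) (t : R) l :
  is_derive t 1 f l <-> forall i j, is_derive t 1 (fun s => f s i j) (l i j).
Proof.
split=> [[df fl] i j|fl].
  have dfi := (derivable_mxP f t 1).1 df i j.
  by apply: DeriveDef => //; rewrite -fl derive_mx// mxE.
have df : derivable f t 1 by apply/derivable_mxP => i j; have [] := fl i j.
apply: DeriveDef => //; rewrite derive_mx//; apply/matrixP => i j.
by rewrite mxE; have [_ ->] := fl i j.
Qed.

Lemma is_derive_ext (V : normedModType R) (f g : R -> V) (t : R) l :
  f =1 g -> is_derive t 1 f l -> is_derive t 1 g l.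
Proof. by move=> /funext ->. Qed.

Lemma is_derive_sumE (p : nat) (f : 'I_p -> R -> R) (t : R) (l : 'I_p -> R) :
  (forall i, is_derive t 1 (f i) (l i)) ->
  is_derive t 1 (fun s => \sum_i f i s) (\sum_i l i).
Proof.
move=> fl; apply: is_derive_ext (is_derive_sum fl) => s.
by rewrite fct_sumE.
Qed.

Lemma is_derive_mulE (f g : R -> R) (t a b : R) :
  is_derive t 1 f a -> is_derive t 1 g b ->
  is_derive t 1 (fun s => f s * g s) (a * g t + f t * b).
Proof.
move=> fa gb; apply: (is_derive_eq (is_deriveM fa gb)).
by rewrite /GRing.scale /= addrC (mulrC a).
Qed.

Lemma is_derive_mulmx (p q r : nat) (f : R -> 'M[R]_(p, q))
    (g : R -> 'M[R]_(q, r)) (t : R) a b :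
  is_derive t 1 f a -> is_derive t 1 g b ->
  is_derive t 1 (fun s => f s *m g s) (a *m g t + f t *m b).
Proof.
move=> /is_derive_mxP fa /is_derive_mxP gb; apply/is_derive_mxP => i j.
have : is_derive t 1 (fun s => \sum_k f s i k * g s k j)
    (\sum_k (a i k * g t k j + f t i k * b k j)).
  by apply: is_derive_sumE => k; exact: is_derive_mulE.
rewrite big_split/= !mxE; apply: is_derive_ext => s.
by rewrite mxE.
Qed.

Lemma is_derive_trmx (p q : nat) (f : R -> 'M[R]_(p, q)) (t : R) a :
  is_derive t 1 f a -> is_derive t 1 (fun s => (f s)^T) a^T.
Proof.
move=> /is_derive_mxP fa; apply/is_derive_mxP => i j; rewrite mxE.
by apply: is_derive_ext (fa j i) => s; rewrite mxE.
Qed.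

Lemma is_derive_scalemx (p q : nat) (c : R -> R) (f : R -> 'M[R]_(p, q))
    (t : R) c' a :
  is_derive t 1 c c' -> is_derive t 1 f a ->
  is_derive t 1 (fun s => c s *: f s) (c' *: f t + c t *: a).
Proof.
move=> cc /is_derive_mxP fa; apply/is_derive_mxP => i j; rewrite !mxE.
by apply: is_derive_ext (is_derive_mulE cc (fa i j)) => s; rewrite mxE.
Qed.

Lemma is_derive_dot (m : nat) (f g : R -> 'cV[R]_m) (t : R) a b :
  is_derive t 1 f a -> is_derive t 1 g b ->
  is_derive t 1 (fun s => dot (f s) (g s)) (dot a (g t) + dot (f t) b).
Proof.
move=> /is_derive_trmx fa gb.
by have /is_derive_mxP/(_ 0 0) := is_derive_mulmx fa gb; rewrite mxE.
Qed.

Lemma is_derive_chain (f g : R -> R) (t a b : R) :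
  is_derive (g t) 1 f a -> is_derive t 1 g b ->
  is_derive t 1 (fun s => f (g s)) (a * b).
Proof. by move=> fa gb; exact: (is_derive1_comp fa gb). Qed.

Lemma is_derive_enorm (m : nat) (f : R -> 'cV[R]_m) (t : R) a :
  f t != 0 -> is_derive t 1 f a ->
  is_derive t 1 (fun s => enorm (f s)) (dot (f t) a / enorm (f t)).
Proof.
move=> ft0 fa; rewrite -enorm_gt0 in ft0.
have d0 : 0 < dot (f t) (f t) by rewrite -enorm_sqr exprn_gt0.
apply: (is_derive_eq
  (is_derive_chain (is_derive1_sqrt d0) (is_derive_dot fa fa))).
rewrite (dotC a) -/(enorm (f t)) invfM.
by field; rewrite gt_eqF.
Qed.

Lemma is_derive_is_cvg (V : normedModType R) (f : R -> V) (t : R) l :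
  is_derive t 1 f l -> f s @[s --> t] --> f t.
Proof.
move=> [df _]; have /derivable1_diffP/differentiable_continuous := df.
exact.
Qed.

(** This multiplicative form also makes sense at [h = 0] and can be integrated in a parameter;
    Gronwall's inequality consumes derivatives in this form. *)
Lemma is_derive_expand (V : normedModType R) (f : R -> V) (t : R) l (e : R) :
  0 < e -> is_derive t 1 f l ->
  \forall h \near (0 : R), `|f (t + h) - f t - h *: l| <= e * `|h|.
Proof.
move=> e0 [df fl].
have : (h^-1 *: (f (h *: 1 + t) - f t)) @[h --> 0^'] --> l.
  by rewrite -fl; exact: df.
move/cvgrPdist_le => /(_ e e0); rewrite near_withinE.
apply: filterS => h hle; have [->|h0] := eqVneq h 0.
  by rewrite scale0r addr0 subrr subr0 !normr0 mulr0.
have := hle h0; rewrite /GRing.scale/= mulr1 (addrC h t) => {}hle.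
have -> : f (t + h) - f t - h *: l = - (h *: (l - h^-1 *: (f (t + h) - f t))).
  by rewrite scalerBr scalerA divff// scale1r opprB.
by rewrite normrN normrZ mulrC ler_wpM2r.
Qed.

Lemma near_addr (s : R) (A : set R) :
  (\forall r \near s, A r) -> \forall h \near (0 : R), A (s + h).
Proof.
have : s + h @[h --> (0 : R)] --> s + 0.
  by apply: cvgD; [exact: cvg_cst|exact: cvg_id].
by rewrite addr0; apply.
Qed.

Lemma near_right (t : R) (A : set R) :
  (\forall h \near t, A h) -> \forall h \near t^'+, A h.
Proof. by move=> At; apply: cvg_within; exact: At. Qed.

End MatrixDerivatives.

(** * Gronwall's inequality and linear differential equations *)

Section Gronwall.
Variable R : realType.

Lemma expR_scale_gt (c k t e : R) : 0 < e ->
  \forall h \near (0 : R),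
    c * expR (k * t) + h * (c * k * expR (k * t)) - e * `|h| <=
    c * expR (k * (t + h)).
Proof.
move=> e0.
have d : is_derive t 1 (fun s => c * expR (k * s)) (c * k * expR (k * t)).
  have dk : is_derive t 1 (fun s : R => k * s) k.
    apply: (is_derive_eq (is_deriveZ k (is_derive_id t 1))).
    by rewrite /GRing.scale/= mulr1.
  apply: (is_derive_eq
    (is_deriveZ c (is_derive_chain (is_derive_expR (k * t)) dk))).
  by rewrite /GRing.scale/=; ring.
apply: filterS (is_derive_expand e0 d) => h.
rewrite ler_norml => /andP[+ _]; rewrite /GRing.scale/=; lra.
Qed.

(* Gronwall's inequality for the upper right Dini derivative: if
   D^+ r <= a r + D e^(lam t) then A e^(lam t) is a supersolution. *)
Lemma gronwall (r : R -> R) (a lam D A : R) :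
  (forall t, 0 < t -> r s @[s --> t^'-] --> r t) ->
  (forall t e, 0 <= t -> 0 < e -> \forall h \near 0^'+,
     r (t + h) <= r t + h * (a * r t + D * expR (lam * t)) + e * h) ->
  r 0 <= A -> D <= A * (lam - a) ->
  forall t, 0 <= t -> r t <= A * expR (lam * t).
Proof.
move=> rc rD r0 DA t t0.
(* The perturbation with rate [a + 1] makes the supersolution strict: it exceeds its own linear
   growth by [e * expR ((a + 1) * s)]. Dividing [e] by its size at [t] lets it vanish there. *)
suff H e : 0 < e -> forall s, 0 <= s ->
    r s <= A * expR (lam * s) + e * expR ((a + 1) * s).
  apply/ler_addgt0Pr => e e0.
  have := H (e / expR ((a + 1) * t)) _ t t0.
  by rewrite divfK ?gt_eqF ?expR_gt0//; apply; rewrite divr_gt0 ?expR_gt0.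
move=> e0; set S := fun s => A * expR (lam * s) + e * expR ((a + 1) * s).
have cS s : {for s, continuous S}.
  by apply: cvgD; apply: cvgM; (try exact: cvg_cst);
    (apply: continuous_comp; last exact: continuous_expR);
    apply: cvgM; (try exact: cvg_cst); exact: cvg_id.
move=> s s0; rewrite leNgt; apply/negP => Ss.
(* First exit time. Left continuity gives [r tau <= S tau] at the infimum, and the Dini bound keeps
   [r] below [S] just after it, which contradicts the infimum. *)
pose E := [set x | 0 <= x /\ S x < r x].
have Einf : has_inf E by split; [exists s|exists 0 => x []].
pose tau := inf E.
have tau0 : 0 <= tau by apply: lb_le_inf => [|x []//]; exact: Einf.1.
have tauE : r tau <= S tau.
  rewrite leNgt; apply/negP => Stau.
  have tau_gt0 : 0 < tau.
    rewrite lt_neqAle tau0 andbT; apply/eqP => tauE.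
    by move: Stau; rewrite -tauE /S !mulr0 expR0 !mulr1; lra.
  have : \forall x \near tau^'-, S x < r x.
    have /cvgr_lt : (S x - r x) @[x --> tau^'-] --> S tau - r tau.
      by apply: cvgB; [exact: cvg_at_left_filter (cS tau)|exact: rc].
    move=> /(_ 0); rewrite subr_lt0 => /(_ Stau).
    by apply: filterS => x; rewrite subr_lt0.
  move=> Snear; near (tau^'-) => x.
  have xE : E x by split; [apply/ltW; near: x; exact: nbhs_left_gt|near: x].
  have : tau <= x by apply: ge_inf => //; exact: Einf.2.
  by apply/negP; rewrite -ltNge; near: x; exact: nbhs_left_lt.
pose q := expR ((a + 1) * tau).
have q0 : 0 < q by exact: expR_gt0.
have p0 : 0 < expR (lam * tau) by exact: expR_gt0.
(* The strict margin [e * q] pays for three errors: the expansions of the two exponentials and the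
   Dini bound. *)
have e3 : 0 < e * q / 3 by rewrite divr_gt0// mulr_gt0.
have : \forall h \near 0^'+, r (tau + h) <= S (tau + h).
  have h1 := expR_scale_gt A lam tau e3.
  have h2 := expR_scale_gt e (a + 1) tau e3.
  have h3 : \forall h \near (0 : R), `|h| * `|a| <= 1.
    have : (`|h| * `|a|) @[h --> (0 : R)] --> `|0 : R| * `|a|.
      by apply: cvgM; [apply: cvg_norm; exact: cvg_id|exact: cvg_cst].
    by rewrite normr0 mul0r => /cvgr_le; apply.
  near=> h.
  have hgt : 0 < h by near: h; exact: nbhs_right_gt.
  have H1 : A * expR (lam * tau) + h * (A * lam * expR (lam * tau)) -
    e * q / 3 * `|h| <=
    A * expR (lam * (tau + h)) by near: h; apply: cvg_within; exact: h1.
  have H2 : e * q + h * (e * (a + 1) * q) - e * q / 3 * `|h| <=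
    e * expR ((a + 1) * (tau + h)) by near: h; apply: cvg_within; exact: h2.
  have H3 : `|h| * `|a| <= 1 by near: h; apply: cvg_within; exact: h3.
  have H4 : r (tau + h) <= r tau + h * (a * r tau + D * expR (lam * tau)) +
    e * q / 3 * h by near: h; exact: rD.
  rewrite (gtr0_norm hgt) in H1 H2 H3.
  (* Only an inequality is known at [tau], so it has to be multiplied by a factor of known sign; [a]
     may be negative. *)
  have ha : 0 <= 1 + h * a.
    have := ler_norm (- (h * a)); rewrite normrN normrM (gtr0_norm hgt); lra.
  have Dp : h * (D * expR (lam * tau)) <=
      h * (A * (lam - a) * expR (lam * tau)).
    by rewrite ler_wpM2l ?(ltW hgt)// ler_wpM2r// ltW.
  have := mulr_ge0 ha (_ : 0 <= S tau - r tau); rewrite subr_ge0 => /(_ tauE).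
  rewrite /S -/q in tauE *; rewrite /S in H1 H2 *.
  set rt := r tau in H4 tauE *.
  set pt := expR (lam * tau) in H1 H4 Dp tauE p0 *.
  have hq : 0 <= h * (e * q) by rewrite mulr_ge0 ?ltW// mulr_gt0.
  move: (expR _) (expR _) H1 H2 H4 => z1 z2; lra.
move=> [/= d d0 dS].
have [x [x0 Sx] xlt] := inf_adherent d0 Einf.
have tx : tau <= x by apply: ge_inf => //; exact: Einf.2.
have {tx} : tau < x.
  by rewrite lt_neqAle tx andbT; apply: contraTneq Sx => <-; rewrite -leNgt.
move=> tx; have := dS (x - tau).
rewrite /ball_ /= sub0r normrN gtr0_norm ?subr_gt0// (addrC tau) subrK.
by rewrite ltrBlDl leNgt Sx => /(_ xlt tx).
Unshelve. all: by end_near. Qed.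

(** Integrating the exponential gains the factor [1 / lam], which is what makes Picard maps contract
    in the weighted norm. Negative times follow by reflecting the curve. With [D = 0] it says that a
    zero derivative forces a constant. *)
Lemma derive_norm_bound (p q : nat) (X v : R -> 'M[R]_(p, q)) (D lam : R) :
  0 < lam -> (forall t : R, is_derive t 1 X (v t)) -> X 0 = 0 ->
  (forall t, `|v t| <= D * expR (lam * `|t|)) ->
  forall t, `|X t| <= D / lam * expR (lam * `|t|).
Proof.
move=> lam0 Xv X0 vD.
suff H (Y w : R -> 'M[R]_(p, q)) :
    (forall t : R, is_derive t 1 Y (w t)) -> Y 0 = 0 ->
    (forall t, `|w t| <= D * expR (lam * `|t|)) ->
    forall t, 0 <= t -> `|Y t| <= D / lam * expR (lam * t).
  move=> t; have [t0|t0] := leP 0 t.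
    by rewrite ger0_norm//; exact: (H X v).
  rewrite ltr0_norm// -[X in X t](_ : (X \o -%R) \o -%R = X); last first.
    by apply/funext => s /=; rewrite opprK.
  apply: (H (X \o -%R) (fun s => - v (- s))) => [s||s|];
    last by rewrite oppr_ge0 ltW.
  - apply/is_derive_mxP => i j; rewrite mxE -mulrN1.
    have /is_derive_mxP/(_ i j) Xij := Xv (- s).
    by apply: (is_derive_chain Xij); apply: is_deriveN.
  - by rewrite /= oppr0.
  - by rewrite normrN (le_trans (vD _))// normrN.
move=> Yw Y0 wD t t0; apply: (@gronwall (fun s => `|Y s|) 0 lam D) => //.
- move=> s _; apply: cvg_at_left_filter; apply: cvg_norm.
  exact: is_derive_is_cvg (Yw s).
- move=> s e s0 e0; near=> h.
  have h0 : 0 < h by near: h; exact: nbhs_right_gt.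
  have : `|Y (s + h) - Y s - h *: w s| <= e * `|h|.
    near: h; apply: cvg_within; exact: is_derive_expand.
  have := ler_normD (Y (s + h) - Y s - h *: w s) (Y s + h *: w s).
  rewrite -[X in `|X + _|]addrA -opprD subrK.
  have := ler_normD (Y s) (h *: w s); rewrite normrZ (gtr0_norm h0) mul0r add0r.
  have : h * `|w s| <= h * (D * expR (lam * s)).
    by rewrite ler_wpM2l ?(ltW h0)// (le_trans (wD s))// ger0_norm.
  rewrite -addrA -opprD; lra.
- rewrite Y0 normr0 divr_ge0 ?(ltW lam0)//.
  by have := vD 0; rewrite normr0 mulr0 expR0 mulr1; exact: le_trans.
- by rewrite subr0 divfK// gt_eqF.
Unshelve. all: by end_near. Qed.

End Gronwall.

(** * Primitives of continuous functions on the whole line *)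

Section Primitive.
Variable R : realType.
Implicit Type f : R -> R.

(** The sign convention at negative times makes the derivative two-sided, also at 0. *)
Definition prim f (t : R) : R :=
  if 0 <= t then \int[lebesgue_measure]_(s in `[0, t]) f s
  else - \int[lebesgue_measure]_(s in `[t, 0]) f s.

Lemma continuous_integrable_itv f a b : continuous f ->
  (@lebesgue_measure R).-integrable `[a, b] (EFin \o f).
Proof.
move=> cf; apply: continuous_compact_integrable; first exact: segment_compact.
exact: continuous_subspaceT.
Qed.

Lemma integrable_itv_oc f a b : continuous f ->
  (@lebesgue_measure R).-integrable `]a, b] (EFin \o f).
Proof.
move=> cf; apply: integrableS (continuous_integrable_itv a b cf) => //.
by apply: subset_itvr; rewrite bnd_simp.
Qed.

(** A base point [a] to the left of both 0 and [t] removes the case distinction, and the fundamental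
    theorem of calculus applies from that base point. *)
Lemma prim_shift f (a t : R) : continuous f -> a <= 0 -> a <= t ->
  prim f t = \int[lebesgue_measure]_(s in `[a, t]) f s -
             \int[lebesgue_measure]_(s in `[a, 0]) f s.
Proof.
move=> cf a0 at_; rewrite /prim; case: ifPn => [t0|].
  rewrite Rintegral_itvB ?bnd_simp//; last exact: continuous_integrable_itv.
  by rewrite Rintegral_itv_obnd_cbnd//; exact: integrable_itv_oc.
rewrite -ltNge => /ltW t0; rewrite -[RHS]opprB; congr (- _).
rewrite Rintegral_itvB ?bnd_simp//; last exact: continuous_integrable_itv.
by rewrite Rintegral_itv_obnd_cbnd//; exact: integrable_itv_oc.
Qed.

Lemma prim0 f : continuous f -> prim f 0 = 0.
Proof. by move=> cf; rewrite (@prim_shift f 0)// subrr. Qed.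

Lemma is_derive_prim f (t : R) : continuous f -> is_derive t 1 (prim f) (f t).
Proof.
move=> cf; pose a := - (`|t| + 1).
have a0 : a <= 0 by rewrite oppr_le0 addr_ge0.
have at_ : a < t by rewrite ltrNl (le_lt_trans (ler_norm _))// normrN ltrDl.
pose c := \int[lebesgue_measure]_(s in `[a, 0]) f s.
pose g x := \int[lebesgue_measure]_(s in `[a, x]) f s.
apply: (@near_eq_is_derive _ _ _ (fun x => g x - c)).
  have : \forall x \near t, a < x by exact: lt_nbhsr.
  by apply: filterS => x /ltW ax; rewrite (@prim_shift f a).
have [dg gE] := continuous_FTC1_closed (ltr_pwDr ltr01 (lexx t))
  (continuous_integrable_itv a (t + 1) cf) at_ (cf t).
have dg' : is_derive t 1 g (f t) :=
  DeriveDef dg (etrans (esym (derive1E g t)) gE).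
apply: (is_derive_eq (is_deriveB dg' (is_derive_cst c t 1))).
by rewrite subr0.
Qed.

Definition mxprim (p q : nat) (X : R -> 'M[R]_(p, q)) (t : R) : 'M[R]_(p, q) :=
  \matrix_(i, j) prim (fun s => X s i j) t.

Lemma continuous_mxP (T : topologicalType) (p q : nat)
    (X : T -> 'M[R]_(p, q)) :
  continuous X <-> forall i j, continuous (fun t => X t i j).
Proof.
by split=> [cX i j t|cX t]; [apply: (cvg_mxP _ _).1; exact: cX|
  apply/cvg_mxP => i j; exact: cX].
Qed.

Lemma is_derive_mxprim (p q : nat) (X : R -> 'M[R]_(p, q)) (t : R) :
  continuous X -> is_derive t 1 (mxprim X) (X t).
Proof.
move=> /continuous_mxP cX; apply/is_derive_mxP => i j.
by apply: is_derive_ext (is_derive_prim t (cX i j)) => s; rewrite mxE.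
Qed.

Lemma mxprim0 (p q : nat) (X : R -> 'M[R]_(p, q)) :
  continuous X -> mxprim X 0 = 0.
Proof.
move=> /continuous_mxP cX; apply/matrixP => i j.
by rewrite !mxE prim0//; exact: cX.
Qed.

End Primitive.

Section WeightedFixpoint.
Variables (R : realType) (p q : nat).
Local Notation curve := (R -> 'M[R]_(p, q)).

(* Picard iteration for the norm sup_t e^(-lam |t|) |X t|. *)
Lemma weighted_fixpoint (Q : set 'M[R]_(p, q)) (T : curve -> curve)
    (lam D0 : R) (X0 : curve) :
  let wt t := expR (lam * `|t|) in
  let P (X : curve) := continuous X /\ forall t, Q (X t) in
  closed Q -> (forall X, P X -> P (T X)) ->
  (forall X Y D, P X -> P Y -> 0 <= D ->
    (forall t, `|X t - Y t| <= D * wt t) ->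
    forall t, `|T X t - T Y t| <= D / 2 * wt t) ->
  P X0 -> 0 <= D0 -> (forall t, `|T X0 t - X0 t| <= D0 * wt t) ->
  exists2 X, P X & T X = X.
Proof.
move=> wt P cQ TP Tc PX0 D00 T0.
pose X k := iter k T X0.
have PX k : P (X k) by elim: k => //= k; exact: TP.
have w0 t : 0 < wt t by exact: expR_gt0.
have step k t : `|X k.+1 t - X k t| <= D0 / 2 ^+ k * wt t.
  elim: k t => [|k IH] t; first by rewrite expr0 divr1; exact: T0.
  have := @Tc (X k.+1) (X k) (D0 / 2 ^+ k) (PX _) (PX _) _ IH t.
  by rewrite exprSr invfM mulrA; apply; rewrite divr_ge0 ?exprn_ge0.
have dist k j t : `|X (j + k)%N t - X k t| <= 2 * (D0 / 2 ^+ k) * wt t.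
  (* The partial geometric sum is kept exact, 2 (1 - 2^-j), so that the induction on [j] closes. *)
  suff H : `|X (j + k)%N t - X k t| <=
      2 * (D0 / 2 ^+ k) * (1 - (2 ^+ j)^-1) * wt t.
    rewrite (le_trans H)// ler_pM2r// ler_piMr ?mulr_ge0 ?invr_ge0 ?exprn_ge0//.
  elim: j => [|j IH].
    by rewrite add0n subrr normr0 expr0 invr1 subrr mulr0 mul0r.
  rewrite addSn -[X in `|X|](subrKA (X (j + k)%N t)).
  rewrite (le_trans (ler_normD _ _))//.
  rewrite (le_trans (lerD (step _ _) IH))// -mulrDl ler_pM2r//.
  rewrite exprD exprS !invfM.
  set a := (2 ^+ j)^-1; set b := (2 ^+ k)^-1; rewrite le_eqVlt; apply/orP; left.
  by apply/eqP; field.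
(* Each entry is a telescoping series dominated by a geometric one. *)
have Xcvg t : cvg (X k t @[k --> \oo]).
  suff H i j : cvg (X k t i j @[k --> \oo]).
    apply/cvg_ex; exists (\matrix_(i, j) lim (X k t i j @[k --> \oo])).
    by apply/cvg_mxP => i j; rewrite mxE; exact: H.
  have -> : (fun k => X k t i j) =
      (fun k => X0 t i j + series (fun k => X k.+1 t i j - X k t i j) k).
    apply/funext => k; rewrite /series /= telescope_sumr//.
    by rewrite addrC subrK.
  apply: is_cvgD; first exact: is_cvg_cst.
  apply: normed_cvg; apply: (@series_le_cvg _ _ (geometric (D0 * wt t) 2^-1)).
  - by move=> n /=.
  - move=> n.
    by rewrite /= mulr_ge0 ?exprn_ge0 ?mulr_ge0 ?(ltW (w0 t))// invr_ge0.
  - move=> n /=; rewrite exprVn mulrAC (le_trans _ (step n t))//.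
    by have := coord_le_norm (X n.+1 t - X n t) i j; rewrite !mxE.
  - apply: is_cvg_geometric_series.
    by rewrite ger0_norm ?invr_ge0// invf_lt1// ltr1n.
pose Y t := lim (X k t @[k --> \oo]).
have XY k t : `|Y t - X k t| <= 2 * (D0 / 2 ^+ k) * wt t.
  have : (`|X j t - X k t|) @[j --> \oo] --> `|Y t - X k t|.
    by apply: cvg_norm; apply: cvgB; [exact: Xcvg|exact: cvg_cst].
  move=> H; rewrite -(cvg_lim _ H)//; apply: limr_le.
    by apply/cvg_ex; eexists; exact: H.
  exists k => // j /= kj; by rewrite -(subnK kj); exact: dist.
have half0 : (2 ^+ k)^-1 @[k --> \oo] --> (0 : R).
  have -> : (fun k => (2 ^+ k)^-1) = geometric (1 : R) 2^-1.
    by apply/funext => k /=; rewrite mul1r exprVn.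
  by apply: cvg_geometric; rewrite ger0_norm ?invr_ge0// invf_lt1// ltr1n.
have small (c e : R) : 0 < e -> \forall k \near \oo, c * (2 ^+ k)^-1 <= e.
  move=> e0; have : c * (2 ^+ k)^-1 @[k --> \oo] --> c * 0.
    by apply: cvgM => //; exact: cvg_cst.
  by rewrite mulr0 => /cvgr_le; apply.
have PY : P Y.
  split=> [t|t]; last first.
    apply: (closed_cvg Q) (Xcvg t) => //.
    by apply: nearW => k; have [] := PX k.
  apply/cvgrPdist_le => e e0.
  have wc : wt s @[s --> t] --> wt t.
    apply: (@cvg_comp _ _ _ (fun s => lam * `|s|) (@expR R)); last first.
      exact: continuous_expR.
    by apply: cvgM; [exact: cvg_cst|exact: norm_continuous].
  have e3 : 0 < e / 3 by rewrite divr_gt0.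
  near \oo => k.
  have Hk : (2 * D0 * (wt t + 1)) * (2 ^+ k)^-1 <= e / 3.
    by near: k; exact: small.
  have /cvgrPdist_le/(_ _ e3) Xk : X k s @[s --> t] --> X k t.
    by have [+ _] := PX k; apply.
  (* A local bound on the weight turns the weighted estimate [XY] into uniform convergence near [t],
     so the limit is continuous. *)
  have wl : \forall s \near t, wt s <= wt t + 1.
    by apply: cvgr_le wc _ _; rewrite ltrDl.
  near=> s.
  have H1 : `|X k t - X k s| <= e / 3 by near: s.
  have H2 : wt s <= wt t + 1 by near: s.
  have H3 r : wt r <= wt t + 1 -> `|Y r - X k r| <= e / 3.
    move=> Hr; apply: le_trans (XY k r) (le_trans _ Hk).
    rewrite (mulrAC (2 * D0)) !mulrA ler_wpM2l// ?mulr_ge0 ?invr_ge0 ?exprn_ge0//.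
  have -> : Y t - Y s = (Y t - X k t) + (X k t - X k s) - (Y s - X k s).
    by rewrite subrKA opprB subrKA.
  have := ler_normB ((Y t - X k t) + (X k t - X k s)) (Y s - X k s).
  have := ler_normD (Y t - X k t) (X k t - X k s).
  have := H3 t; have := H3 s H2; rewrite lerDl ler01 => ? /(_ isT) ?.
  lra.
exists Y => //; apply/funext => t; apply/eqP.
rewrite -subr_eq0 -normr_le0; apply/ler_addgt0Pr => e e0; rewrite add0r.
near \oo => k.
have H1 : (D0 * wt t) * (2 ^+ k)^-1 <= e / 3.
  by near: k; apply: small; rewrite divr_gt0.
have H2 := XY k.+1 t.
have H3 := @Tc Y (X k) (2 * (D0 / 2 ^+ k)) PY (PX k) _ (XY k) t.
(* [X k.+1] is [T (X k)]: the first difference is small by contraction, the second because the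
   iterates tend to [Y]. *)
have -> : T Y t - Y t = (T Y t - T (X k) t) - (Y t - X k.+1 t).
  by rewrite opprB subrKA.
rewrite (le_trans (ler_normB _ _))//.
have {}H3 := H3 (mulr_ge0 (ler0n _ 2) (divr_ge0 D00 (exprn_ge0 k (ler0n _ 2)))).
rewrite exprS invfM in H2.
rewrite (le_trans (lerD H3 H2))//.
move: H1; set b := (2 ^+ k)^-1; set w := wt t => H1.
rewrite (_ : _ + _ = 2 * (D0 * w * b)); last by field.
lra.
Unshelve. all: by end_near. Qed.

End WeightedFixpoint.

(** * Fundamental matrices of linear equations *)

Section LinearODE.
Variables (R : realType) (m : nat).
Implicit Types (A B : 'M[R]_m).

Lemma norm_mulmx_le A B : `|A *m B| <= m%:R * `|A| * `|B|.
Proof.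
apply: norm_le_coord => [|i j]; first by rewrite !mulr_ge0.
rewrite mxE (le_trans (ler_norm_sum _ _ _))//.
rewrite (le_trans (_ : _ <= \sum_(i < m) `|A| * `|B|))//; last first.
  by rewrite sumr_const card_ord mulr_natl mulrnAl.
by apply: ler_sum => k _; rewrite normrM ler_pM//; exact: coord_le_norm.
Qed.

Lemma linear_ode (M : R -> 'M[R]_m) (C : R) :
  continuous M -> (forall t, `|M t| <= C) ->
  exists2 Phi : R -> 'M[R]_m, Phi 0 = 1%:M &
    forall t : R, is_derive t 1 Phi (M t *m Phi t).
Proof.
move=> cM MC.
have C0 : 0 <= C by exact: le_trans (MC 0).
(* The right-hand side is Lipschitz with constant [m%:R * C] in the entrywise norm, so this rate
   gives a contraction factor below 1/2. *)
pose lam := 2 * (m%:R * C) + 1.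
have mC0 : 0 <= m%:R * C by rewrite mulr_ge0.
have lam0 : 0 < lam by rewrite /lam; lra.
have cMX (X : R -> 'M[R]_m) : continuous X -> continuous (fun t => M t *m X t).
  by move=> cX t; apply: cvg_mulmx; [exact: cM|exact: cX].
pose T (X : R -> 'M[R]_m) := fun t => 1%:M + mxprim (fun s => M s *m X s) t.
have dT (X : R -> 'M[R]_m) (t : R) : continuous X ->
    is_derive t 1 (T X) (M t *m X t).
  move=> cX; apply: (is_derive_eq (is_deriveD (is_derive_cst 1%:M t 1)
    (is_derive_mxprim t (cMX X cX)))).
  by rewrite add0r.
have T0 (X : R -> 'M[R]_m) : continuous X -> T X 0 = 1%:M.
  by move=> cX; rewrite /T mxprim0 ?addr0//; exact: cMX.
have cT (X : R -> 'M[R]_m) : continuous X -> continuous (T X).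
  by move=> cX t; exact: is_derive_is_cvg (dT X t cX).
have [|||||Phi [cPhi _] TPhi] := @weighted_fixpoint R m m setT T lam
    (m%:R * C * `|1%:M : 'M[R]_m| / lam) (fun=> 1%:M) closedT.
- by move=> X [cX _]; split => //; exact: cT.
- move=> X Y D [cX _] [cY _] D0 XYD t.
  apply: (le_trans (@derive_norm_bound R m m (fun t => T X t - T Y t)
     (fun t => M t *m X t - M t *m Y t) (m%:R * C * D) lam lam0 _ _ _ t)).
  + by move=> s; apply: is_deriveB; exact: dT.
  + by rewrite !T0// subrr.
  + move=> s; rewrite -mulmxBr (le_trans (norm_mulmx_le _ _))//.
    by rewrite -[leRHS]mulrA ler_pM ?mulr_ge0// ler_wpM2l.
  + rewrite ler_wpM2r ?expR_ge0// ler_pdivrMr// /lam.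
    by move: mC0; set k := m%:R * C => k0; nra.
- by split => // t; exact: cvg_cst.
- by rewrite !mulr_ge0// invr_ge0 ltW.
- have cc : continuous (fun _ : R => 1%:M : 'M[R]_m).
    by move=> t; exact: cvg_cst.
  apply: (@derive_norm_bound R m m (fun t => T (fun=> 1%:M) t - 1%:M)
     (fun t => M t *m 1%:M) _ lam lam0).
  + move=> t.
    apply: (is_derive_eq (is_deriveB (dT _ t cc) (is_derive_cst 1%:M t 1))).
    by rewrite subr0.
  + by rewrite T0// subrr.
  + move=> t; rewrite (le_trans (norm_mulmx_le _ _))//.
    rewrite (le_trans (_ : _ <= m%:R * C * `|1%:M : 'M[R]_m|))//.
      by rewrite ler_wpM2r// ler_wpM2l.
    rewrite ler_peMr ?mulr_ge0// -expR0 ler_expR mulr_ge0// ltW//.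
exists Phi; first by rewrite -TPhi T0.
by move=> t; rewrite -[in X in is_derive _ _ X]TPhi; exact: dT.
Qed.

Lemma derive0_cst (p q : nat) (X : R -> 'M[R]_(p, q)) :
  (forall t : R, is_derive t 1 X (0 : 'M[R]_(p, q))) ->
  forall t, X t = X 0.
Proof.
move=> X0 t; apply/eqP; rewrite -subr_eq0 -normr_le0.
have := @derive_norm_bound R p q (fun t => X t - X 0) (fun=> 0) 0 1 ltr01 _ _ _ t.
rewrite !mul0r subrr; apply => // s; last by rewrite normr0 mul0r.
apply: (is_derive_eq (is_deriveB (X0 s) (is_derive_cst (X 0) s 1))).
by rewrite subr0.
Qed.

(** The inverse comes from an equation of its own: [B] is the transpose of the solution of Y' = -
    M^T Y, and the derivative of [B Phi] is - B M Phi + B M Phi = 0. Its differentiability is thus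
    part of the construction. *)
Lemma linear_flow (M : R -> 'M[R]_m) (C : R) :
  continuous M -> (forall t, `|M t| <= C) ->
  exists Phi B : R -> 'M[R]_m,
    [/\ Phi 0 = 1%:M,
        forall t : R, is_derive t 1 Phi (M t *m Phi t),
        forall t : R, is_derive t 1 B (- (B t *m M t)) &
        forall t, B t *m Phi t = 1%:M].
Proof.
move=> cM MC; have [Phi Phi0 dPhi] := linear_ode cM MC.
have [||Bt Bt0 dBt] := @linear_ode (fun t => - (M t)^T) C.
- by move=> t; apply: cvgN; apply: cvg_trmx; exact: cM.
- move=> t; rewrite normrN; apply: norm_le_coord => [|i j].
    exact: le_trans (MC t).
  by rewrite mxE (le_trans _ (MC t))// coord_le_norm.
have dB (t : R) : is_derive t 1 (fun s => (Bt s)^T) (- ((Bt t)^T *m M t)).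
  apply: (is_derive_eq (is_derive_trmx (dBt t))).
  by rewrite trmx_mul linearN /= trmxK mulmxN.
exists Phi, (fun t => (Bt t)^T); split => // t.
have -> : 1%:M = (Bt 0)^T *m Phi 0 by rewrite Phi0 Bt0 trmx1 mulmx1.
apply: (derive0_cst (X := fun s => (Bt s)^T *m Phi s)) => s.
apply: (is_derive_eq (is_derive_mulmx (dB s) (dPhi s))).
by rewrite mulNmx mulmxA addNr.
Qed.

End LinearODE.

(** * The sphere as a compact measurable space *)

Section SphereTopology.
Variables (R : realType) (n : nat).
Local Notation S := (sphere R n).
Implicit Types (x y : S).

Lemma sphere_enorm x : enorm (sphere_val x) = 1.
Proof. by case: x => v vS; exact: (set_mem vS). Qed.

Lemma sphere_val_inj : injective (@sphere_val R n).
Proof. exact: val_inj. Qed.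

Lemma sphere_dot x : dot (sphere_val x) (sphere_val x) = 1.
Proof. by rewrite -enorm_sqr sphere_enorm expr1n. Qed.

Lemma continuous_sphere_val : continuous (@sphere_val R n).
Proof. exact: initial_continuous. Qed.

Lemma continuous_sphere_coord i :
  continuous (fun x : S => sphere_val x i 0).
Proof.
move=> x; have /cvg_mxP := @continuous_sphere_val x.
by move=> H; exact: H.
Qed.

Lemma cvg_sphereP (T : Type) (F : set_system T) {FF : Filter F}
    (f : T -> S) x :
  sphere_val (f t) @[t --> F] --> sphere_val x -> f t @[t --> F] --> x.
Proof.
move=> fx A /= [_ [[B oB <-] /= Bx BA]].
have FB : \forall t \near F, B (sphere_val (f t)).
  by apply: fx; exact: open_nbhs_nbhs.
by apply: filterS FB => t Bt; exact: BA.
Qed.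

(** At [v = 0] no point qualifies and the value is the default [point]. *)
Definition sphere_proj (v : 'cV[R]_n.+1) : S :=
  xget point [set x : S | sphere_val x = (enorm v)^-1 *: v].

Lemma sphere_projE (v : 'cV[R]_n.+1) : v != 0 ->
  sphere_val (sphere_proj v) = (enorm v)^-1 *: v.
Proof.
move=> v0; rewrite /sphere_proj; case: xgetP => // /(_ _)/=.
have vS : @sphere_set R n ((enorm v)^-1 *: v).
  rewrite /sphere_set /= enormZ ger0_norm ?invr_ge0 ?enorm_ge0// mulVf//.
  by rewrite enorm_eq0.
pose y : S := @exist _ (fun v => v \in @sphere_set R n) _ (mem_set vS).
by move=> /(_ y erefl).
Qed.

Lemma sphere_projK x : sphere_proj (sphere_val x) = x.
Proof.
apply: sphere_val_inj; rewrite sphere_projE.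
  by rewrite sphere_enorm invr1 scale1r.
by rewrite -enorm_eq0 sphere_enorm oner_neq0.
Qed.

Lemma cvg_sphere_proj (T : Type) (F : set_system T) {FF : Filter F}
    (f : T -> 'cV[R]_n.+1) (v : 'cV[R]_n.+1) : v != 0 ->
  f t @[t --> F] --> v -> sphere_proj (f t) @[t --> F] --> sphere_proj v.
Proof.
move=> v0 fv; apply: cvg_sphereP; rewrite sphere_projE//.
have fv' : enorm (f t) @[t --> F] --> enorm v by exact: cvg_enorm.
have : (enorm (f t))^-1 *: f t @[t --> F] --> (enorm v)^-1 *: v.
  have v1 : enorm v != 0 by rewrite enorm_eq0.
  exact: (cvgZ (cvgV v1 fv') fv).
apply: cvg_trans; apply: near_eq_cvg.
have /(cvgr_gt _ fv') : 0 < enorm v by rewrite enorm_gt0.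
by apply: filterS => t; rewrite enorm_gt0 => /sphere_projE.
Qed.

(** Heine-Borel is applied to row vectors; the sphere type is the image of the closed bounded set of
    unit rows under transposition and normalization. *)
Lemma sphere_compact : compact [set: S].
Proof.
pose A := [set v : 'rV[R]_n.+1 | enorm v^T = 1].
have ctr : continuous (fun v : 'rV[R]_n.+1 => v^T).
  by move=> v; apply: (@cvg_trmx _ _ (nbhs v) _ _ _ id); exact: cvg_id.
have cA : compact A.
  apply: bounded_closed_compact.
    exists 1; split => // M M1 v /= v1.
    apply: le_trans (ltW M1); apply: norm_le_coord => // i j.
    have := coord_le_enorm v^T j; rewrite v1 mxE.
    by rewrite (ord1 i).
  have -> : A = (fun v : 'rV[R]_n.+1 => enorm v^T) @^-1` [set 1] by [].
  apply: preimage_closed; last exact: closed_eq.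
  by move=> v _; apply: (@cvg_enorm _ _ (nbhs v) _ _ trmx); exact: ctr.
have -> : [set: S] = (fun v : 'rV[R]_n.+1 => sphere_proj v^T) @` A.
  apply/esym/seteqP; split => // x _; exists (sphere_val x)^T.
    by rewrite /A /= trmxK sphere_enorm.
  by rewrite trmxK sphere_projK.
apply: continuous_compact => //; apply: continuous_in_subspaceT => v.
rewrite inE /A /= => v1; apply: (@cvg_sphere_proj _ (nbhs v)); last exact: ctr.
by rewrite -enorm_eq0 v1 oner_neq0.
Qed.

(** The near-covering form of compactness: a property that holds locally in x, with [i] far enough
    along the filter, holds for all x at once. Uniformity in x is drawn from here throughout. *)
Lemma sphere_unif (I : Type) (F : set_system I) {FF : Filter F}
    (P : I -> S -> Prop) :
  (forall x, \forall y \near x & i \near F, P i y) ->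
  \forall i \near F, forall x, P i x.
Proof.
move=> Px; have /compact_near_coveringP/(_ I F P FF) := sphere_compact.
move=> /(_ (fun x _ => Px x)); apply: filterS => i Pi x.
exact: Pi.
Qed.

Lemma unif_cvg (T : topologicalType) (w : T * S -> R) (t : T) (e : R) :
  0 < e -> (forall x, {for (t, x), continuous w}) ->
  \forall s \near t, forall x, `|w (s, x) - w (t, x)| <= e.
Proof.
move=> e0 cw; apply: sphere_unif => x.
have e2 : 0 < e / 2 by rewrite divr_gt0.
have /cvgrPdist_le/(_ _ e2) : w p @[p --> (t, x)] --> w (t, x) by exact: cw.
move=> [[/= A B] [At Bx] AB].
exists (B, A) => //= -[y s] /= [By As].
have H1 := AB (s, y) (conj As By).
have H2 := AB (t, y) (conj (nbhs_singleton At) By).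
rewrite /= in H1 H2.
have := ler_normB (w (t, x) - w (t, y)) (w (t, x) - w (s, y)).
have -> : w (t, x) - w (t, y) - (w (t, x) - w (s, y)) = w (s, y) - w (t, y).
  by ring.
lra.
Qed.

Lemma continuous_sphere_bounded (f : S -> R) : continuous f ->
  exists2 K, 0 < K & forall x, `|f x| <= K.
Proof.
move=> cf; have /compact_bounded[M [_ Mf]] : compact (f @` [set: S]).
  apply: continuous_compact; last exact: sphere_compact.
  exact: continuous_subspaceT.
exists (`|M| + 1); first by rewrite ltr_wpDl.
move=> x; apply: Mf; last by exists x.
by rewrite (le_lt_trans (ler_norm _))// ltrDl.
Qed.

Lemma continuous_measurable_sphere (f : S -> R) : continuous f ->
  measurable_fun [set: S] f.
Proof.
move=> /continuousP cf; apply: (measurability _ (RGenOpens.measurableE R)).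
move=> _ [_ [a [b ->] <-]]; rewrite setTI; apply: sub_sigma_algebra.
exact/cf/interval_open.
Qed.

Lemma continuous_measurable_self (f : S -> S) : continuous f ->
  measurable_fun [set: S] f.
Proof.
move=> /continuousP cf; apply: (@measurability _ _ _ _ _ _ (@open S)) => //.
by move=> _ [A oA <-]; rewrite setTI; apply: sub_sigma_algebra; exact: cf.
Qed.

Lemma continuous_integrable_sphere (mu : Psphere R n) (f : S -> R) :
  continuous f -> mu.-integrable [set: S] (EFin \o f).
Proof.
move=> cf; apply: measurable_bounded_integrable => //.
- by rewrite (le_lt_trans (probability_le1 mu _))// ltry.
- exact: continuous_measurable_sphere.
- have [K K0 fK] := continuous_sphere_bounded cf.
  exists K; split => [|M KM]; first exact: gtr0_real.
  move=> x _.
  exact: le_trans (fK x) (ltW KM).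
Qed.

End SphereTopology.

(** * Integrals, couplings and the Wasserstein distance *)

Section ProbabilityIntegrals.
Context {R : realType} {d : measure_display} {T : measurableType d}.
Variable P : probability T R.
Implicit Types f g : T -> R.

Lemma bounded_integrable f K : measurable_fun [set: T] f ->
  (forall x, `|f x| <= K) -> P.-integrable [set: T] (EFin \o f).
Proof.
move=> mf fK; apply: measurable_bounded_integrable => //.
- by rewrite (le_lt_trans (probability_le1 P _))// ltry.
- have K0 : 0 <= K by rewrite (le_trans _ (fK point)).
  exists K; split => [|M KM x _]; first exact: ger0_real.
  exact: le_trans (fK x) (ltW KM).
Qed.

Lemma EFin_Rintegral f : P.-integrable [set: T] (EFin \o f) ->
  (\int[P]_x f x)%:E = (\int[P]_x (f x)%:E)%E.
Proof. by move=> fi; rewrite /Rintegral fineK//; exact: integrable_fin_num. Qed.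

Lemma Rintegral_const (c : R) : \int[P]_x c = c.
Proof.
rewrite Rintegral_cst// [X in fine X](_ : _ = 1%E) ?mulr1//.
exact: probability_setT.
Qed.

Lemma Rintegral_le_cst f (c : R) : P.-integrable [set: T] (EFin \o f) ->
  (forall x, f x <= c) -> \int[P]_x f x <= c.
Proof.
move=> fi fc; rewrite -[leRHS]Rintegral_const; apply: le_Rintegral => //.
exact: (@bounded_integrable _ `|c|).
Qed.

Lemma normr_Rintegral_le f (c : R) : P.-integrable [set: T] (EFin \o f) ->
  (forall x, `|f x| <= c) -> `|\int[P]_x f x| <= c.
Proof.
move=> fi fc; rewrite (le_trans (le_normr_Rintegral _ _))//.
by apply: Rintegral_le_cst => //; exact: integrable_norm.
Qed.

Lemma normr_RintegralB_le f g (c : R) : P.-integrable [set: T] (EFin \o f) ->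
  P.-integrable [set: T] (EFin \o g) -> (forall x, `|f x - g x| <= c) ->
  `|\int[P]_x f x - \int[P]_x g x| <= c.
Proof.
move=> fi gi fgc; rewrite -RintegralB//; apply: normr_Rintegral_le => //.
exact: (integrableB measurableT fi gi).
Qed.

Lemma Rintegral_le_affine f g (a c : R) :
  P.-integrable [set: T] (EFin \o f) -> P.-integrable [set: T] (EFin \o g) ->
  (forall x, f x <= a * g x + c) -> \int[P]_x f x <= a * \int[P]_x g x + c.
Proof.
move=> fi gi fgc; have agi := integrableZl measurableT a gi.
rewrite -RintegralZl// -lerBlDl -RintegralB//.
apply: Rintegral_le_cst => [|x]; first exact: (integrableB measurableT fi agi).
by rewrite lerBlDl.
Qed.

Lemma normr_Rintegral_expand_le f g k (h c : R) :
  P.-integrable [set: T] (EFin \o f) -> P.-integrable [set: T] (EFin \o g) ->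
  P.-integrable [set: T] (EFin \o k) ->
  (forall x, `|f x - g x - h * k x| <= c) ->
  `|\int[P]_x f x - \int[P]_x g x - h * \int[P]_x k x| <= c.
Proof.
move=> fi gi ki fgkc; rewrite -RintegralZl// -RintegralB//.
apply: normr_RintegralB_le => //; first exact: (integrableB measurableT fi gi).
exact: (integrableZl measurableT h ki).
Qed.

End ProbabilityIntegrals.

Section Dist.
Context {R : realType} {n : nat} {d : measure_display} {T : measurableType d}.
Local Notation S := (sphere R n).
Implicit Types (f g : T -> S).

Definition dist f g (z : T) : R := enorm (sphere_val (f z) - sphere_val (g z)).

Lemma measurable_dist f g : measurable_fun [set: T] f ->
  measurable_fun [set: T] g -> measurable_fun [set: T] (dist f g).
Proof.
move=> mf mg; rewrite /dist /enorm.
have mc (h : T -> S) i : measurable_fun [set: T] h ->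
    measurable_fun [set: T] (fun z => sphere_val (h z) i 0).
  move=> mh; apply: (measurableT_comp (f := fun x : S => sphere_val x i 0)) => //.
  apply: (@continuous_measurable_sphere _ _ (fun x => sphere_val x i 0)).
  exact: continuous_sphere_coord.
apply: (measurableT_comp (f := @Num.sqrt R)).
  by apply: continuous_measurable_fun; exact: sqrt_continuous.
under eq_fun do rewrite dotE.
apply: measurable_sum => i.
have mB : measurable_fun [set: T]
    (fun z => (sphere_val (f z) - sphere_val (g z)) i 0).
  under eq_fun do rewrite !mxE.
  by apply: measurable_funB; exact: mc.
exact: measurable_funM.
Qed.

Lemma dist_ge0 f g z : 0 <= dist f g z. Proof. exact: enorm_ge0. Qed.

Lemma dist_le2 f g z : dist f g z <= 2.
Proof. by rewrite (le_trans (ler_enormB _ _))// !sphere_enorm. Qed.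

End Dist.

Section Transport.
Context {R : realType} {n : nat} {d : measure_display} {T : measurableType d}.
Local Notation S := (sphere R n).
Variable P : probability T R.
Implicit Types (f g : T -> S) (mu nu : Psphere R n).

(** The law of [f] is required to agree with [mu] on measurable sets only, so that the lemma covers
    both pushforwards and the marginals of a coupling. *)
Lemma Rintegral_image mu f (psi : S -> R) : measurable_fun [set: T] f ->
  (forall A, measurable A -> mu A = P (f @^-1` A)) -> continuous psi ->
  \int[mu]_x psi x = \int[P]_z psi (f z).
Proof.
move=> mf muP cpsi.
have mpsi := continuous_measurable_sphere cpsi.
have [K K0 psiK] := continuous_sphere_bounded cpsi.
pose mff : {mfun T >-> S} :=
  MeasurableFun.Pack (MeasurableFun.Class (isMeasurableFun.Build _ _ _ _ _ mf)).
rewrite /Rintegral; congr fine.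
rewrite (@eq_measure_integral _ _ _ _ (distribution P mff)); last first.
  by move=> A mA _; exact: muP.
rewrite integral_distribution//; first exact/measurable_EFinP.
apply: (@bounded_integrable _ _ _ _ (psi \o f) K) => [|z]; last exact: psiK.
exact: measurableT_comp.
Qed.

Lemma integrable_dist f g : measurable_fun [set: T] f ->
  measurable_fun [set: T] g -> P.-integrable [set: T] (EFin \o dist f g).
Proof.
move=> mf mg; apply: (@bounded_integrable _ _ _ _ _ 2).
  exact: measurable_dist.
by move=> z; rewrite ger0_norm ?dist_ge0// dist_le2.
Qed.

(** The joint law of [f] and [g] under [P] is a coupling. Upper bounds on [W1] are obtained this
    way. *)
Lemma W1_le_dist mu nu f g :
  measurable_fun [set: T] f -> measurable_fun [set: T] g ->
  (forall A, measurable A -> mu A = P (f @^-1` A)) ->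
  (forall A, measurable A -> nu A = P (g @^-1` A)) ->
  (W1 mu nu <= (\int[P]_z dist f g z)%:E)%E.
Proof.
move=> mf mg muP nuP.
have mfg := measurable_fun_pair mf mg.
pose h : {mfun T >-> (S * S)%type} :=
  MeasurableFun.Pack (MeasurableFun.Class (isMeasurableFun.Build _ _ _ _ _ mfg)).
rewrite EFin_Rintegral; last exact: integrable_dist.
apply: ereal_inf_lbound; exists (distribution P h).
  by move=> A mA; rewrite muP// nuP.
rewrite ge0_integral_distribution//.
- apply/measurable_EFinP.
  apply: (measurable_dist (f := fst) (g := snd)).
    exact: measurable_fst.
  exact: measurable_snd.
- by move=> z; rewrite lee_fin enorm_ge0.
Qed.

End Transport.

Section Wasserstein.
Context {R : realType} {n : nat}.
Local Notation S := (sphere R n).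
Implicit Types (mu nu : Psphere R n).

Lemma W1_ge0 mu nu : (0 <= W1 mu nu)%E.
Proof.
apply: le_ereal_inf_tmp => _ [pi _ <-]; apply: integral_ge0 => z _.
by rewrite lee_fin enorm_ge0.
Qed.

Lemma coupling_dist mu nu (pi : probability (S * S)%type R) :
  coupling mu nu pi ->
  (\int[pi]_z (enorm (sphere_val z.1 - sphere_val z.2))%:E)%E =
  (\int[pi]_z dist fst snd z)%:E.
Proof.
move=> _; rewrite EFin_Rintegral//; apply: integrable_dist => //.
Qed.

Lemma W1_eq0 mu nu : measure_eq mu nu -> W1 mu nu = 0%E.
Proof.
move=> munu; apply/eqP; rewrite eq_le W1_ge0 andbT.
rewrite (le_trans (@W1_le_dist _ _ _ _ mu mu nu id id _ _ _ _))//.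
  by move=> A mA; rewrite munu.
rewrite lee_fin; apply: Rintegral_le_cst; first exact: integrable_dist.
by move=> x; rewrite /dist subrr enorm0.
Qed.

Lemma W1_dirac_le2 mu (p : S) : (W1 mu (dirac p : Psphere R n) <= 2%:E)%E.
Proof.
rewrite (le_trans (@W1_le_dist _ _ _ _ mu mu _ id (cst p) _ _ _ _))//.
  move=> A mA; rewrite /= diracE; case: (boolP (p \in A)) => pA.
    rewrite (_ : _ @^-1` _ = setT); first by rewrite probability_setT.
    by apply/seteqP; split => // x _ /=; exact: set_mem.
  rewrite (_ : _ @^-1` _ = set0); first by rewrite measure0.
  by apply/seteqP; split => // x /= /mem_set; apply/negP.
rewrite lee_fin; apply: Rintegral_le_cst; first exact: integrable_dist.
exact: dist_le2.
Qed.

Lemma nbhs_sphereP (x : S) (A : set S) : nbhs x A ->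
  exists2 e : R, 0 < e &
    forall y, enorm (sphere_val y - sphere_val x) < e -> A y.
Proof.
move=> [_ [[B oB <-] /= Bx BA]].
have /nbhs_ballP[e /= e0 eB] : nbhs (sphere_val x) B by exact: open_nbhs_nbhs.
exists e => // y yx; apply: BA; apply: eB; rewrite -ball_normE /ball_ /=.
rewrite distrC (le_lt_trans _ yx)//; apply: norm_le_coord => [|i j].
  exact: enorm_ge0.
by rewrite ord1; exact: coord_le_enorm.
Qed.

(** Lipschitz up to an additive [e]: a bound affine in the distance can be integrated against a
    coupling. *)
Lemma continuous_modulus (psi : S -> R) (e : R) : continuous psi -> 0 < e ->
  exists2 K, 0 <= K & forall x y,
    `|psi x - psi y| <= e + K * enorm (sphere_val x - sphere_val y).
Proof.
move=> cpsi e0; have [B B0 psiB] := continuous_sphere_bounded cpsi.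
suff : \forall K \near +oo, forall x y,
    `|psi x - psi y| <= e + K * enorm (sphere_val x - sphere_val y).
  move=> H; near (pinfty_nbhs R) => K; exists K => //; near: K => //.
apply: sphere_unif => x0.
have e2 : 0 < e / 2 by rewrite divr_gt0.
have /cvgrPdist_le/(_ _ e2)/nbhs_sphereP[r r0 xr] := cpsi x0.
have r2 : 0 < r / 2 by rewrite divr_gt0.
(* For [x] within [r / 2] of [x0], either [y] is within [r] of [x0] and continuity at [x0] applies,
   or [x] and [y] are at least [r / 2] apart and [K] times their distance exceeds the oscillation
   [2 * B]. *)
exists ([set x | enorm (sphere_val x - sphere_val x0) < r / 2],
        [set K : R | 2 * B / (r / 2) <= K]).
  split => /=; last by apply: nbhs_pinfty_ge; exact: num_real.
  have : enorm (sphere_val x - sphere_val x0) @[x --> x0] -->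
         enorm (sphere_val x0 - sphere_val x0).
    apply: (@cvg_enorm _ _ (nbhs x0) _ _
      (fun x : S => sphere_val x - sphere_val x0)).
    by apply: cvgB; [exact: continuous_sphere_val|exact: cvg_cst].
  by rewrite subrr enorm0 => /cvgr_lt; apply.
move=> -[x K] /= [xx0 BK] y.
have K0 : 0 <= K by rewrite (le_trans _ BK)// divr_ge0 ?mulr_ge0 ?ltW.
have [yx0|yx0] := ltP (enorm (sphere_val y - sphere_val x0)) r.
  have H1 := xr _ yx0; have H2 := xr x (lt_trans xx0 (_ : r / 2 < r)).
  have {}H2 := H2 (ltac:(lra)).
  have H3 := mulr_ge0 K0 (enorm_ge0 (sphere_val x - sphere_val y)).
  have -> : psi x - psi y = (psi x0 - psi y) - (psi x0 - psi x) by ring.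
  by rewrite (le_trans (ler_normB _ _))//; lra.
have xy : r / 2 <= enorm (sphere_val x - sphere_val y).
  have := ler_enorm_dist (sphere_val y) (sphere_val x) (sphere_val x0).
  rewrite (enormC (sphere_val y) (sphere_val x)); lra.
have H1 : 2 * B <= K * enorm (sphere_val x - sphere_val y).
  rewrite (le_trans _ (ler_wpM2l K0 xy))// -ler_pdivrMr//.
have := psiB x; have := psiB y; have := ler_normB (psi x) (psi y); lra.
Unshelve. all: by end_near. Qed.

(** The affine modulus is integrated against a coupling of cost below [dl]; the denominator [K + 1]
    keeps [K] times this cost below [e / 2]. The threshold is uniform in both measures. *)
Lemma W1_weak (psi : S -> R) (e : R) : continuous psi -> 0 < e ->
  exists2 dl : R, 0 < dl & forall mu nu, (W1 mu nu < dl%:E)%E ->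
    `|\int[mu]_x psi x - \int[nu]_x psi x| <= e.
Proof.
move=> cpsi e0; have e2 : 0 < e / 2 by rewrite divr_gt0.
have [K K0 psiK] := continuous_modulus cpsi e2.
exists (e / 2 / (K + 1)); first by rewrite divr_gt0// ltr_wpDl.
move=> mu nu /ereal_inf_lt[_ [pi cpi <-]].
rewrite (coupling_dist cpi) lte_fin => dpi.
have m1 : measurable_fun [set: S * S] fst by exact: measurable_fst.
have m2 : measurable_fun [set: S * S] snd by exact: measurable_snd.
rewrite (Rintegral_image (P := pi) m1 _ cpsi);
  last by move=> A mA; have [] := cpi A mA.
rewrite (Rintegral_image (P := pi) m2 _ cpsi);
  last by move=> A mA; have [] := cpi A mA.
have mpsi := continuous_measurable_sphere cpsi.
have [B B0 psiB] := continuous_sphere_bounded cpsi.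
have i1 : pi.-integrable setT (EFin \o (psi \o fst)).
  apply: (@bounded_integrable _ _ _ _ _ B); first exact: measurableT_comp mpsi m1.
  by move=> z; exact: psiB.
have i2 : pi.-integrable setT (EFin \o (psi \o snd)).
  apply: (@bounded_integrable _ _ _ _ _ B); first exact: measurableT_comp mpsi m2.
  by move=> z; exact: psiB.
have idist := integrable_dist pi m1 m2.
have iB : pi.-integrable setT (EFin \o (fun z => psi z.1 - psi z.2)).
  exact: (integrableB measurableT i1 i2).
rewrite -RintegralB// (le_trans (le_normr_Rintegral _ _))//.
have ce : pi.-integrable setT (EFin \o (fun=> e / 2)).
  exact: (@bounded_integrable _ _ _ _ _ `|e / 2|).
have Kd : pi.-integrable setT (EFin \o (fun z => K * dist fst snd z)).
  exact: (integrableZl measurableT K idist).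
rewrite (@le_trans _ _ (\int[pi]_z (e / 2 + K * dist fst snd z)))//.
  apply: le_Rintegral => //; first exact: integrable_norm.
  exact: (integrableD measurableT ce Kd).
rewrite RintegralD// Rintegral_const RintegralZl//.
move: dpi; rewrite ltr_pdivlMr ?ltr_wpDl//.
set I := \int[pi]_z _.
have I0 : 0 <= I by apply: Rintegral_ge0 => z _; exact: dist_ge0.
nra.
Qed.

End Wasserstein.

(** * Separation of measures by smooth functions *)

Section Gradients.
Variables (R : realType) (m : nat).
Implicit Types (f : 'cV[R]_m -> R) (g : 'cV[R]_m -> 'cV[R]_m).

(* C^1 functions. The gradient g is characterised by derivatives along curves,
   which is all that is_sgrad asks for. *)
Definition has_gradient f g :=
  [/\ continuous f, continuous g &
    forall (c : R -> 'cV[R]_m) (s : R) (v : 'cV[R]_m), is_derive s 1 c v ->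
      is_derive s 1 (fun r => f (c r)) (dot (g (c s)) v)].

Lemma has_gradient_cst (a : R) : has_gradient (fun=> a) (fun=> 0).
Proof.
split; [exact: cst_continuous|exact: cst_continuous|].
move=> c s v _; apply: (is_derive_eq (is_derive_cst a s 1)).
by rewrite dot0l.
Qed.

Lemma has_gradient_dot (q : 'cV[R]_m) : has_gradient (dot q) (fun=> q).
Proof.
split.
- by move=> v; apply: (cvg_dot (F := nbhs v)); [exact: cvg_cst|exact: cvg_id].
- exact: cst_continuous.
- move=> c s v cv.
  apply: (is_derive_eq (is_derive_dot (is_derive_cst q s 1) cv)).
  by rewrite dot0l add0r.
Qed.

Lemma has_gradient_mul f1 g1 f2 g2 : has_gradient f1 g1 ->
  has_gradient f2 g2 ->
  has_gradient (fun v => f1 v * f2 v) (fun v => f2 v *: g1 v + f1 v *: g2 v).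
Proof.
move=> [cf1 cg1 d1] [cf2 cg2 d2]; split.
- by move=> v; apply: (cvgM (F := nbhs v)); [exact: cf1|exact: cf2].
- move=> v; apply: (cvgD (F := nbhs v)); apply: (cvgZ (F := nbhs v));
    [exact: cf2|exact: cg1|exact: cf1|exact: cg2].
- move=> c s v cv.
  apply: (is_derive_eq (is_derive_mulE (d1 c s v cv) (d2 c s v cv))).
  by rewrite dotDl !dotZl mulrC.
Qed.

Lemma has_gradient_comp (h h' : R -> R) f g :
  (forall y : R, is_derive y 1 h (h' y)) -> continuous h' ->
  has_gradient f g ->
  has_gradient (fun v => h (f v)) (fun v => h' (f v) *: g v).
Proof.
move=> dh ch' [cf cg d]; split.
- move=> v; apply: (@cvg_comp _ _ _ f h); first exact: cf.
  exact: is_derive_is_cvg (dh (f v)).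
- move=> v; apply: (cvgZ (F := nbhs v)); last exact: cg.
  by apply: (@cvg_comp _ _ _ f h'); [exact: cf|exact: ch'].
- move=> c s v cv; rewrite dotZl.
  exact: (is_derive_chain (g := fun r => f (c r)) (dh _) (d c s v cv)).
Qed.

End Gradients.

(** * Caps as a generating pi-system, approximated by smooth functions *)

Section SoftCaps.
Variables (R : realType) (n : nat).
Local Notation S := (sphere R n).

(** A smooth step built from exponentials. The shift [k] settles the value at [a = 0]: there the
    bump is exp(- exp k), which tends to 0, so the limit is the indicator of the open half-line. The
    factor [k ^+ 2] beats the shift when [a > 0]. *)
Definition bump (k a : R) : R := expR (- expR (k - k ^+ 2 * a)).

Lemma bump_ge0 k a : 0 <= bump k a. Proof. exact: expR_ge0. Qed.

Lemma bump_le1 k a : bump k a <= 1.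
Proof. by rewrite -expR0 ler_expR oppr_le0 expR_ge0. Qed.

Lemma cvg_bump (a : R) :
  bump k%:R a @[k --> \oo] --> ((0 < a)%R%:R : R).
Proof.
have e0 : expR (- k%:R) @[k --> \oo] --> (0 : R) by exact: cvgn_expR.
have [a0|a0] := ltP 0 a => /=; last first.
  apply: (@squeeze_cvgr _ _ _ _ (fun=> 0) (fun k => expR (- k%:R))) => //; last first.
    exact: cvg_cst.
  apply: nearW => k; rewrite bump_ge0/= ler_expR lerN2.
  have H1 := expR_ge1Dx (k%:R : R).
  have : expR k%:R <= expR (k%:R - k%:R ^+ 2 * a).
    by rewrite ler_expR lerDl oppr_ge0 mulr_ge0_le0// exprn_ge0.
  by apply: le_trans; rewrite (le_trans _ H1)// lerDr.
have -> : true%:R = expR (- 0 : R) by rewrite oppr0 expR0.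
have : expR (k%:R - k%:R ^+ 2 * a) @[k --> \oo] --> 0.
  apply: (@squeeze_cvgr _ _ _ _ (fun=> 0) (fun k => expR (- k%:R))) => //; last first.
    exact: cvg_cst.
  near=> k; rewrite expR_ge0/= ler_expR.
  (* From here on k - k^2 a is at most - k. *)
  have : 2 / a <= k%:R by near: k; exact: nbhs_infty_ger.
  rewrite ler_pdivrMr// => ka.
  have := ler_wpM2l (ler0n R k) ka; nra.
move=> H.
apply: (@cvg_comp _ _ _ (fun k => - expR (k%:R - k%:R ^+ 2 * a)) (@expR R)).
  by apply: cvgN; exact: H.
exact: continuous_expR.
Unshelve. all: by end_near. Qed.

(* Smooth approximations, as k tends to infinity, of the indicator of a finite
   intersection of spherical caps. *)
Definition softcap (s : seq ('cV[R]_n.+1 * R)) (k : R) (v : 'cV[R]_n.+1) : R :=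
  \prod_(p <- s) bump k (dot p.1 v - p.2).

Lemma softcap_gradient s k : exists g, has_gradient (softcap s k) g.
Proof.
elim: s => [|p s [g IH]].
  exists (fun=> 0); rewrite /softcap; under eq_fun do rewrite big_nil.
  exact: has_gradient_cst.
have d2 (y : R) : is_derive y 1 (fun a => k - k ^+ 2 * (a - p.2)) (- k ^+ 2).
  apply: (is_derive_eq (is_deriveB (is_derive_cst k y 1)
    (is_deriveZ (k ^+ 2)
      (is_deriveB (is_derive_id y 1) (is_derive_cst p.2 y 1))))).
  by rewrite /GRing.scale/= subr0 mulr1 sub0r.
have d1 := fun y : R => is_derive_chain (is_derive_expR _) (d2 y).
have d (y : R) : is_derive y 1 (fun a => bump k (a - p.2))
    (bump k (y - p.2) * (- (expR (k - k ^+ 2 * (y - p.2)) * - k ^+ 2))).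
  exact: (is_derive_chain (is_derive_expR _) (is_deriveN (d1 y))).
have cont : continuous (fun y => bump k (y - p.2) *
    (- (expR (k - k ^+ 2 * (y - p.2)) * - k ^+ 2))).
  move=> y; apply: cvgM; first exact: is_derive_is_cvg (d y).
  apply: cvgN; apply: cvgM; last exact: cvg_cst.
  exact: is_derive_is_cvg (d1 y).
have H := has_gradient_mul (has_gradient_comp d cont (has_gradient_dot p.1)) IH.
eexists; rewrite /softcap; under eq_fun do rewrite big_cons.
exact: H.
Qed.

Lemma softcap_bounds s k v : 0 <= softcap s k v <= 1.
Proof.
rewrite /softcap; elim/big_ind : _ => [|x y /andP[x0 x1] /andP[y0 y1]|p _].
- by rewrite ler01 lexx.
- by rewrite mulr_ge0//= mulr_ile1.
- by rewrite bump_ge0 bump_le1.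
Qed.

(** With lists of half-spaces, intersection is concatenation, and the empty list gives the whole
    sphere. *)
Definition caps (s : seq ('cV[R]_n.+1 * R)) : set S :=
  [set x | all (fun p => p.2 < dot p.1 (sphere_val x)) s].

Lemma cvg_softcap s (x : S) :
  softcap s k%:R (sphere_val x) @[k --> \oo] --> (\1_(caps s) x : R).
Proof.
rewrite indicE.
have -> : x \in caps s = all (fun p => p.2 < dot p.1 (sphere_val x)) s.
  by apply/idP/idP => [/set_mem|/mem_set].
elim: s => [|p s IH].
  by rewrite /softcap; under eq_fun do rewrite big_nil; exact: cvg_cst.
rewrite /softcap; under eq_fun do rewrite big_cons.
rewrite /= -mulnb natrM; apply: cvgM; last exact: IH.
by rewrite -subr_gt0; exact: cvg_bump.
Qed.

Lemma open_caps s : open (caps s).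
Proof.
elim: s => [|p s IH].
  by rewrite (_ : caps _ = setT) ?predeqE//; exact: openT.
rewrite (_ : caps _ =
  (fun x : S => dot p.1 (sphere_val x)) @^-1` [set y | p.2 < y] `&` caps s).
  apply: openI => //; apply: open_comp => [x _|]; last exact: open_gt.
  apply: (@cvg_dot _ _ (nbhs x) _ _ (fun=> p.1)); first exact: cvg_cst.
  exact: continuous_sphere_val.
by apply/seteqP; split => x /=; rewrite /caps /= => /andP.
Qed.

Lemma measurable_caps s : measurable (caps s).
Proof. by apply: sub_sigma_algebra; exact: open_caps. Qed.

Lemma has_gradient_sphere (f : 'cV[R]_n.+1 -> R) g : has_gradient f g ->
  continuous (fun x : S => f (sphere_val x)).
Proof.
move=> [cf _ _] x; apply: (@cvg_comp _ _ _ (@sphere_val R n) f).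
  exact: continuous_sphere_val.
exact: cf.
Qed.

Lemma measure_caps (mu : Psphere R n) s :
  (\int[mu]_x softcap s k%:R (sphere_val x))%:E @[k --> \oo] --> mu (caps s).
Proof.
have cs k : continuous (fun x : S => softcap s k (sphere_val x)).
  by have [g /has_gradient_sphere] := softcap_gradient s k.
have -> : mu (caps s) = (\int[mu]_x (\1_(caps s) x)%:E)%E.
  by rewrite integral_indic ?setIT//; exact: measurable_caps.
under eq_fun do rewrite (EFin_Rintegral (continuous_integrable_sphere mu (cs _))).
apply: (@dominated_cvg _ _ _ mu setT measurableT _ _ (cst 1%E)) => //.
- by move=> k; apply/measurable_EFinP; exact: continuous_measurable_sphere.
- by move=> x _; apply: cvg_EFin; [exact: nearW|exact: cvg_softcap].
- apply: (@bounded_integrable _ _ _ mu (cst 1) 1) => // x.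
  by rewrite /cst /= normr1.
- move=> k x _; rewrite abse_EFin lee_fin ger0_norm.
    by have /andP[] := softcap_bounds s k%:R (sphere_val x).
  by have /andP[] := softcap_bounds s k%:R (sphere_val x).
Qed.

Lemma approx_rat (v : 'cV[R]_n.+1) (e : R) : 0 < e ->
  exists q : 'cV[rat]_n.+1, enorm (v - map_mx ratr q) < e.
Proof.
move=> e0; have en : 0 < e / n.+1%:R by rewrite divr_gt0.
have H i : exists q : rat, `|v i 0 - ratr q| < e / n.+1%:R.
  have [q] := @rat_in_itvoo R (v i 0 - e / n.+1%:R) (v i 0 + e / n.+1%:R)
    (ltac:(by rewrite ltrD2l gtrN)).
  by rewrite in_itv/= => qv; exists q; rewrite ltr_distlC.
exists (\col_i xchoose (H i)); rewrite (le_lt_trans (enorm_le_sum _))//.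
rewrite [ltRHS](_ : e = \sum_(i < n.+1) e / n.+1%:R); last first.
  by rewrite sumr_const card_ord -[RHS]mulr_natr divfK.
apply: ltr_sum; first by apply/hasP; exists 0 => //; exact: mem_index_enum.
by move=> i _; rewrite !mxE; exact: (xchooseP (H i)).
Qed.

(** For unit vectors, |y - x|^2 = 2 - 2 <x, y>. If q is within [dl] of x and <q, y> > 1 - dl, then
    <x, y> > 1 - 2 dl and |y - x|^2 < 4 dl, which explains the choice of [dl] below r^2 / 4. *)
Lemma nbhs_cap (x : S) (U : set S) : nbhs x U ->
  exists p : 'cV[rat]_n.+1 * rat,
    let c := caps [:: (map_mx ratr p.1, ratr p.2)] in c x /\ c `<=` U.
Proof.
move=> /nbhs_sphereP[r r0 rU].
have [dl] : exists dl : rat, ratr dl \in `]0, (r ^+ 2 / 4 : R)[.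
  by apply: rat_in_itvoo; rewrite divr_gt0// exprn_gt0.
rewrite in_itv/= => /andP[dl0 dlr].
have [q xq] := approx_rat (sphere_val x) dl0.
set qr := map_mx ratr q in xq.
have close (y : S) : `|dot (sphere_val x - qr) (sphere_val y)| < ratr dl.
  by rewrite (le_lt_trans (normr_dot_le _ _))// sphere_enorm mulr1.
exists (q, 1 - dl) => /=; rewrite rmorphB rmorph1 -/qr; split.
  rewrite /caps /= andbT.
  have := close x; rewrite dotDl dotNl sphere_dot ltr_norml => /andP[_]; lra.
move=> y; rewrite /caps /= andbT => yq; apply: rU.
have := close y; rewrite dotDl dotNl ltr_norml => /andP[xy _].
rewrite -(@ltr_pXn2r _ 2) ?nnegrE ?enorm_ge0// ?ltW//.
rewrite enorm_sqr dotDl !dotDr !dotNl !dotNr !sphere_dot.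
rewrite (dotC (sphere_val y) (sphere_val x)); lra.
Qed.

(** Caps with rational parameters form a countable base, enumerated by [pickle]; codes that are
    invalid, or whose cap leaves [U], contribute the empty set. *)
Lemma sphere_sigma_caps :
  @measurable _ S = <<s range caps >>.
Proof.
apply/seteqP; split; last first.
  apply: smallest_sub; first exact: sigma_algebra_measurable.
  by move=> _ [s _ <-]; exact: measurable_caps.
apply: smallest_sub; first exact: smallest_sigma_algebra.
move=> U oU.
pose C k : set S := match unpickle k with
  | Some p =>
     let c := caps
       [:: (map_mx ratr (p.1 : 'cV[rat]_n.+1), ratr (p.2 : rat))] in
     if `[< c `<=` U >] then c else set0
  | None => set0 end.
have -> : U = \bigcup_k C k.
  apply/seteqP; split => [x Ux|x [k _]].
    have /nbhs_cap[p [px pU]] : nbhs x U by exact: open_nbhs_nbhs.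
    exists (pickle p) => //; rewrite /C pickleK /=.
    by case: asboolP.
  rewrite /C; case: unpickle => [p|//] /=.
  by case: asboolP => // cU; exact: cU.
apply: sigma_algebra_bigcup => k; rewrite /C.
case: unpickle => [p|] /=; last exact: sigma_algebra0.
case: asboolP => _; last exact: sigma_algebra0.
by apply: sub_sigma_algebra; eexists.
Qed.

(** Integrals of the soft caps determine the measures of caps in the limit, and finite measures that
    agree on a generating pi-system coincide. *)
Lemma measure_separation (mu nu : Psphere R n) :
  (forall f g, has_gradient f g ->
     \int[mu]_x f (sphere_val x) = \int[nu]_x f (sphere_val x)) ->
  measure_eq mu nu.
Proof.
move=> munu A mA.
apply: (@measure_unique _ _ _ (range caps) (fun=> setT)) => //.
- exact: sphere_sigma_caps.
- move=> _ _ [s _ <-] [s' _ <-]; exists (s ++ s') => //.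
  by apply/seteqP; split => x; rewrite /caps /= all_cat => /andP.
- by move=> _; exists [::] => //; apply/seteqP; split.
- by rewrite bigcup_const//.
- move=> _ [s _ <-].
  have H := @measure_caps mu s; have H' := @measure_caps nu s.
  suff E : (fun k => (\int[mu]_x softcap s k%:R (sphere_val x))%:E) =
      (fun k => (\int[nu]_x softcap s k%:R (sphere_val x))%:E).
    by rewrite E in H; exact: (cvg_unique _ H H').
  apply/funext => k; have [g sg] := softcap_gradient s k%:R.
  by rewrite (munu _ _ sg).
- by move=> k; rewrite (le_lt_trans (probability_le1 mu _))// ltry.
Qed.

End SoftCaps.

(** * Projective action of linear flows *)

Section Tangent.
Variables (R : realType) (m : nat).
Implicit Types (x y z v w : 'cV[R]_m).

Definition tang z w := w - dot z w *: z.

Lemma tangE z w : (1%:M - z *m z^T) *m w = tang z w.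
Proof.
rewrite mulmxBl mul1mx -mulmxA (mx11_scalar (z^T *m w)).
by rewrite mul_mx_scalar.
Qed.

Lemma tangD z v w : tang z (v + w) = tang z v + tang z w.
Proof. by rewrite /tang dotDr scalerDl opprD addrACA. Qed.

Lemma tangZ z c w : tang z (c *: w) = c *: tang z w.
Proof. by rewrite /tang dotZr scalerBr scalerA. Qed.

Lemma tangN z w : tang z (- w) = - tang z w.
Proof. by rewrite -scaleN1r tangZ scaleN1r. Qed.

Lemma dot_tang z v w : dot (tang z v) w = dot v (tang z w).
Proof. by rewrite /tang !dot_linE (dotC z w) mulrC (dotC z v). Qed.

Lemma dot_tang_orth z w : enorm z = 1 -> dot z (tang z w) = 0.
Proof.
by move=> z1; rewrite /tang !dot_linE -enorm_sqr z1 expr1n mulr1 subrr.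
Qed.

Lemma enorm_tang z w : enorm z = 1 -> enorm (tang z w) <= enorm w.
Proof.
move=> z1; rewrite -(@ler_pXn2r _ 2) ?nnegrE ?enorm_ge0// !enorm_sqr.
have zz : dot z z = 1 by rewrite -enorm_sqr z1 expr1n.
rewrite /tang !dot_linE zz (dotC w z).
have := sqr_ge0 (dot z w); lra.
Qed.

Definition normalize y := (enorm y)^-1 *: y.

Lemma is_derive_normalize (y : R -> 'cV[R]_m) (t : R) w :
  y t != 0 -> is_derive t 1 y w ->
  is_derive t 1 (fun s => normalize (y s))
    ((enorm (y t))^-1 *: tang (normalize (y t)) w).
Proof.
move=> y0 yw; have n0 : enorm (y t) != 0 by rewrite enorm_eq0.
have H := is_derive_scalemx (@is_deriveV R (fun s => enorm (y s)) t _ 1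
  n0 (is_derive_enorm y0 yw)) yw.
apply: (is_derive_eq H).
rewrite /tang /normalize dotZl scalerBr !scalerA addrC; congr (_ + _).
rewrite -scaleNr; congr (_ *: _); rewrite /GRing.scale/=.
by field.
Qed.

End Tangent.

Section FlowMaps.
Variables (R : realType) (n : nat).
Local Notation S := (sphere R n).
Implicit Types (A B : 'M[R]_n.+1) (x : S).

(* The action of an invertible matrix on directions. The junk value for a
   singular A is the identity, so that nmap A is continuous for every A. *)
Definition nmap A x : S :=
  if A \in unitmx then sphere_proj (A *m sphere_val x) else x.

Lemma unitmx_sphere_neq0 A x : A \in unitmx -> A *m sphere_val x != 0.
Proof.
move=> uA; apply/eqP => Ax; have := sphere_enorm x.
rewrite -(mulKmx uA (sphere_val x)) Ax mulmx0 enorm0 => /esym/eqP.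
by rewrite oner_eq0.
Qed.

Lemma nmapE A x : A \in unitmx ->
  sphere_val (nmap A x) = normalize (A *m sphere_val x).
Proof. by move=> uA; rewrite /nmap uA sphere_projE// unitmx_sphere_neq0. Qed.

Lemma nmap1 x : nmap 1%:M x = x.
Proof. by rewrite /nmap unitmx1 mul1mx sphere_projK. Qed.

Lemma nmapK A B : B *m A = 1%:M -> cancel (nmap A) (nmap B).
Proof.
move=> BA x; have [uB uA] := mulmx1_unit BA.
apply: sphere_val_inj; rewrite nmapE// nmapE//.
rewrite /normalize -scalemxAr mulmxA BA mul1mx enormZ sphere_enorm mulr1.
rewrite scalerA ger0_norm ?invr_ge0 ?enorm_ge0// mulVf ?scale1r//.
by rewrite invr_eq0 enorm_eq0 unitmx_sphere_neq0.
Qed.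

Lemma cvg_nmap (T : Type) (F : set_system T) {FF : Filter F}
    (f : T -> 'M[R]_n.+1) (y : T -> S) A x :
  (forall t, f t \in unitmx) -> A \in unitmx ->
  f t @[t --> F] --> A -> y t @[t --> F] --> x ->
  nmap (f t) (y t) @[t --> F] --> nmap A x.
Proof.
move=> uf uA fA yx; rewrite /nmap uA; under eq_fun do rewrite uf.
apply: cvg_sphere_proj; first exact: unitmx_sphere_neq0.
apply: cvg_mulmx => //.
apply: (@cvg_comp _ _ _ y (@sphere_val R n) _ (nbhs x)) => //.
exact: continuous_sphere_val.
Qed.

Lemma continuous_nmap A : continuous (nmap A).
Proof.
move=> x; have [uA|uA] := boolP (A \in unitmx).
  by apply: (@cvg_nmap _ (nbhs x) _ (fun=> A) id) => //; exact: cvg_cst.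
by rewrite /continuous_at /nmap (negbTE uA); exact: cvg_id.
Qed.

Lemma measurable_nmap A : measurable_fun [set: S] (nmap A).
Proof. by apply: continuous_measurable_self; exact: continuous_nmap. Qed.

HB.instance Definition _ A :=
  isMeasurableFun.Build _ _ _ _ (nmap A) (measurable_nmap A).

(** Matrix and point move together: a constant [c] gives the time derivative along the flow, a
    constant [Phi] the differential of [nmap] needed for spherical gradients. *)
Lemma is_derive_nmap (Phi : R -> 'M[R]_n.+1) (c : R -> S) (t : R) dPhi v :
  (forall s, Phi s \in unitmx) -> is_derive t 1 Phi dPhi ->
  is_derive t 1 (fun s => sphere_val (c s)) v ->
  is_derive t 1 (fun s => sphere_val (nmap (Phi s) (c s)))
    ((enorm (Phi t *m sphere_val (c t)))^-1 *:
      tang (sphere_val (nmap (Phi t) (c t)))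
        (dPhi *m sphere_val (c t) + Phi t *m v)).
Proof.
move=> uPhi dP dc; rewrite nmapE//.
apply: is_derive_ext (is_derive_normalize _ (is_derive_mulmx dP dc)) => [s|].
  by rewrite nmapE.
exact: unitmx_sphere_neq0.
Qed.

(** The factor 1 / |Phi x| produced by normalization turns M Phi x into M applied to the point of
    the flow, so the equation closes on the sphere. *)
Lemma is_derive_flow (Phi : R -> 'M[R]_n.+1) (M : 'M[R]_n.+1) (t : R) x :
  (forall s, Phi s \in unitmx) -> is_derive t 1 Phi (M *m Phi t) ->
  is_derive t 1 (fun s => sphere_val (nmap (Phi s) x))
    (tang (sphere_val (nmap (Phi t) x)) (M *m sphere_val (nmap (Phi t) x))).
Proof.
move=> uPhi dP.
apply: (is_derive_eq
  (is_derive_nmap (c := fun=> x) uPhi dP (is_derive_cst _ t 1))).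
rewrite mulmx0 addr0 -tangZ -mulmxA.
by rewrite [in X in _ = tang _ (_ *m X)]nmapE// /normalize scalemxAr.
Qed.

(** The mean value theorem along s -> t + s h, which treats both signs of [h], replaces the
    increment by [w] at an intermediate time; continuity of [w] at time [t] is uniform in x. *)
Lemma unif_expand (u w : R -> S -> R) (t e : R) : 0 < e ->
  (forall x (s : R), is_derive s 1 (u ^~ x) (w s x)) ->
  (forall x, {for (t, x), continuous (fun p : R * S => w p.1 p.2)}) ->
  \forall h \near (0 : R), forall x,
    `|u (t + h) x - u t x - h * w t x| <= e * `|h|.
Proof.
move=> e0 du cw.
have /nbhs_ballP[r /= r0 rw] := unif_cvg e0 cw.
exists r => //= h; rewrite /ball_/= sub0r normrN => hr x.
have dphi (s : R) :
    is_derive s 1 (fun s => u (t + s * h) x) (w (t + s * h) x * h).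
  apply: (is_derive_chain (g := fun s => t + s * h) (du x _)).
  apply: (is_derive_eq (is_deriveD (is_derive_cst t s 1)
    (is_derive_mulE (is_derive_id s 1) (is_derive_cst h s 1)))).
  by rewrite add0r mul1r mulr0 addr0.
have [|c] := @MVT_segment R (fun s => u (t + s * h) x)
    (fun s => w (t + s * h) x * h) 0 1 ler01 (fun s _ => dphi s).
  apply: continuous_subspaceT => s; exact: is_derive_is_cvg (dphi s).
rewrite in_itv/= mul1r mul0r addr0 subr0 mulr1 => /andP[c0 c1] ->.
rewrite (mulrC h) -mulrBl normrM ler_wpM2r//.
apply: rw; rewrite -ball_normE /ball_/= opprD addrA subrr sub0r normrN normrM.
by rewrite ger0_norm// (le_lt_trans _ hr)// ler_piMl.
Qed.

End FlowMaps.

(** * Integrals along continuous curves of measures *)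

Section Clamp.
Variable R : realType.

(* Curves of measures carry no information at negative times; composing them
   with clamp gives curves that are continuous on the whole real line. *)
Definition clamp (t : R) : R := Num.max 0 t.

Lemma clamp_ge0 t : 0 <= clamp t.
Proof. by rewrite le_max lexx. Qed.

Lemma clampE t : 0 <= t -> clamp t = t.
Proof. by move=> t0; rewrite /clamp max_r. Qed.

Lemma continuous_clamp : continuous clamp.
Proof.
by move=> t; apply: (@continuous_max _ _ (fun=> 0) id);
  [exact: cvg_cst|exact: cvg_id].
Qed.

Lemma cvg_clamp t : clamp s @[s --> t] -->
  within [set s | 0 <= s] (nbhs (clamp t)).
Proof.
move=> A; rewrite /within /= => cA.
have := continuous_clamp cA; rewrite !near_simpl /=.
by apply: filterS => s; apply; exact: clamp_ge0.
Qed.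

End Clamp.

Section WeakContinuity.
Context {R : realType} {n : nat}.
Local Notation S := (sphere R n).
Implicit Types (rho : R -> Psphere R n).

Lemma W1_clamp_lt rho (t dl : R) : W1_continuous rho -> 0 < dl ->
  \forall s \near t, (W1 (rho (clamp s)) (rho (clamp t)) < dl%:E)%E.
Proof.
move=> crho d0.
have : W1 (rho (clamp s)) (rho (clamp t)) @[s --> t] --> 0%E.
  apply: (@cvg_comp _ _ _ (@clamp R) (fun s => W1 (rho s) (rho (clamp t))));
    [exact: cvg_clamp|exact: crho (clamp_ge0 t)].
move=> /fine_cvgP[fW /cvgr_lt W0].
have {}W0 := W0 dl d0.
near=> s; have sf : W1 (rho (clamp s)) (rho (clamp t)) \is a fin_num by near: s.
by rewrite -(fineK sf) lte_fin; near: s.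
Unshelve. all: by end_near. Qed.

(** Two errors: the integrand moves uniformly in x, and the measure moves with the integrand frozen
    at time [t]. *)
Lemma cvg_Rintegral_curve rho (psi : R -> S -> R) (t : R) :
  W1_continuous rho -> (forall s, continuous (psi s)) ->
  (forall x, {for (t, x), continuous (fun p : R * S => psi p.1 p.2)}) ->
  \int[rho (clamp s)]_x psi s x @[s --> t] --> \int[rho (clamp t)]_x psi t x.
Proof.
move=> crho cpsi jpsi; apply/cvgrPdist_le => e e0.
have e2 : 0 < e / 2 by rewrite divr_gt0.
have [dl dl0 Hd] := W1_weak (cpsi t) e2.
near=> s.
have H1 :
    `|\int[rho (clamp s)]_x psi t x - \int[rho (clamp t)]_x psi t x| <= e / 2.
  by apply: Hd; near: s; exact: W1_clamp_lt.
have H2 :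
    `|\int[rho (clamp s)]_x psi s x - \int[rho (clamp s)]_x psi t x| <= e / 2.
  apply: normr_RintegralB_le; [exact: continuous_integrable_sphere..|].
  by near: s; exact: (unif_cvg e2 jpsi).
rewrite distrC -(subrKA (\int[rho (clamp s)]_x psi t x)).
rewrite (le_trans (ler_normD _ _))//; lra.
Unshelve. all: by end_near. Qed.

End WeakContinuity.

(** * The mean-field equation *)

Lemma cvg_tang (R : realType) (m : nat) (T : Type) (F : set_system T)
    {FF : Filter F} (f g : T -> 'cV[R]_m) (z w : 'cV[R]_m) :
  f t @[t --> F] --> z -> g t @[t --> F] --> w ->
  tang (f t) (g t) @[t --> F] --> tang z w.
Proof.
move=> fz gw; apply: cvgB => //; apply: cvgZ => //.
exact: cvg_dot.
Qed.

(** Origin of the constant 3: the terms A (x - y), <x, A y> (x - y) and <x - y, A y> y each cost C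
    |x - y|. What remains is the change of matrix, tested at y only. *)
Lemma tang_lipschitz (R : realType) (m : nat) (A A' : 'M[R]_m) (C : R)
    (x y : 'cV[R]_m) :
  0 <= C -> (forall v, enorm (A *m v) <= C * enorm v) ->
  enorm x = 1 -> enorm y = 1 ->
  enorm (tang x (A *m x) - tang y (A' *m y)) <=
    3 * C * enorm (x - y) + enorm ((A - A') *m y).
Proof.
move=> C0 AC x1 y1.
have -> : tang x (A *m x) - tang y (A' *m y) =
    tang x (A *m (x - y)) + (- (dot x (A *m y) *: (x - y)) -
      dot (x - y) (A *m y) *: y) + tang y ((A - A') *m y).
  rewrite mulmxBr mulmxBl !tangD !tangN /tang.
  rewrite dotDl dotNl scalerBr scalerBl.
  move: (A *m x) (A *m y) (A' *m y) => a b c.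
  apply/colP => i; rewrite !mxE; ring.
have H1 : enorm (tang x (A *m (x - y))) <= C * enorm (x - y).
  by rewrite (le_trans (enorm_tang _ x1)).
have Ay : enorm (A *m y) <= C by rewrite (le_trans (AC y))// y1 mulr1.
have H2 : enorm (- (dot x (A *m y) *: (x - y))) <= C * enorm (x - y).
  rewrite enormN enormZ ler_wpM2r ?enorm_ge0//.
  by rewrite (le_trans (normr_dot_le _ _))// x1 mul1r.
have H3 : enorm (dot (x - y) (A *m y) *: y) <= C * enorm (x - y).
  rewrite enormZ y1 mulr1 (le_trans (normr_dot_le _ _))// mulrC.
  by rewrite ler_wpM2r ?enorm_ge0.
have H4 := enorm_tang ((A - A') *m y) y1.
have H5 := ler_enormB (- (dot x (A *m y) *: (x - y)))
  (dot (x - y) (A *m y) *: y).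
rewrite (le_trans (ler_enormD _ _))// (_ : 3 * C * _ = C * enorm (x - y) +
  (C * enorm (x - y) + C * enorm (x - y))); last by ring.
rewrite lerD// (le_trans (ler_enormD _ _))// lerD// (le_trans H5)// lerD//.
Qed.

(** A product rule in increments: from [c] to [b] the measure changes, from [b] to [a] the test
    function does, and the first-order terms [- k] and [d] cancel up to [e / 3]. *)
Lemma split_increment_le (R : realFieldType) (a b c d k h e : R) : 0 < h ->
  `|b - c - h * - k| <= e / 3 * h -> `|a - b - h * d| <= e / 3 * h ->
  `|k - d| <= e / 3 -> `|a - c| <= e * h.
Proof.
move=> h0; rewrite !ler_norml => /andP[? ?] /andP[? ?] /andP[H1 H2].
have := ler_wpM2l (ltW h0) H1; have := ler_wpM2l (ltW h0) H2 => ? ?.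
by apply/andP; split; lra.
Qed.

Section MeanField.
Variables (R : realType) (n : nat) (F : Psphere R n -> 'M[R]_n.+1) (L : R).
Local Notation S := (sphere R n).
Implicit Types (mu nu : Psphere R n) (rho : R -> Psphere R n).
Hypothesis L_ge0 : 0 <= L.
Hypothesis F_lip : forall mu nu,
  ((opnorm (F mu - F nu))%:E <= L%:E * W1 mu nu)%E.

Lemma driftE (x : S) mu :
  drift F x mu = tang (sphere_val x) (F mu *m sphere_val x).
Proof. by rewrite /drift -mulmxA tangE. Qed.

(** Every measure is compared with one fixed Dirac mass, at [W1] distance at most the diameter 2. *)
Lemma opnorm_has_sup_range : has_sup (range (fun mu => opnorm (F mu))).
Proof.
pose nu : Psphere R n := dirac (point : S).
split; first by exists (opnorm (F nu)); exists nu.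
exists (opnorm (F nu) + L * 2) => _ [mu _ <-].
apply: opnorm_le => [|x]; first by rewrite addr_ge0 ?opnorm_ge0// mulr_ge0.
have -> : F mu *m x = F nu *m x + (F mu - F nu) *m x.
  by rewrite -mulmxDl addrC subrK.
rewrite (le_trans (ler_enormD _ _))// mulrDl lerD ?enorm_mulmx//.
rewrite (le_trans (enorm_mulmx _ _))// ler_wpM2r ?enorm_ge0// -lee_fin.
rewrite (le_trans (F_lip _ _))// EFinM lee_wpmul2l ?lee_fin//.
exact: W1_dirac_le2.
Qed.

Lemma opnorm_le_CF mu : opnorm (F mu) <= CF F.
Proof. by apply: sup_upper_bound; [exact: opnorm_has_sup_range|exists mu]. Qed.

Lemma CF_ge0 : 0 <= CF F.
Proof. exact: le_trans (opnorm_ge0 _) (opnorm_le_CF (dirac (point : S))). Qed.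

Lemma enorm_F_le mu x : enorm (F mu *m x) <= CF F * enorm x.
Proof.
by rewrite (le_trans (enorm_mulmx _ _))// ler_wpM2r ?enorm_ge0// opnorm_le_CF.
Qed.

Lemma norm_F_le mu : `|F mu| <= CF F.
Proof. by rewrite (le_trans (norm_le_opnorm _))// opnorm_le_CF. Qed.

Lemma opnormB_le mu nu (c : R) : (W1 mu nu <= c%:E)%E ->
  opnorm (F mu - F nu) <= L * c.
Proof.
move=> Wc; rewrite -lee_fin (le_trans (F_lip _ _))// EFinM.
by rewrite lee_wpmul2l ?lee_fin.
Qed.

Lemma continuous_F_curve rho : W1_continuous rho ->
  continuous (fun t => F (rho (clamp t))).
Proof.
move=> crho t; apply/cvgrPdist_le => /= e e0.
have L1 : 0 < L + 1 by rewrite ltr_wpDl.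
have dl0 : 0 < e / (L + 1) by rewrite divr_gt0.
apply: filterS (W1_clamp_lt t crho dl0) => s /ltW/opnormB_le H.
rewrite distrC (le_trans (norm_le_opnorm _))// (le_trans H)//.
by rewrite mulrCA ler_piMr ?(ltW e0)// ler_pdivrMr// mul1r lerDl.
Qed.

(** The inner integral of the weak formulation is continuous in time, so the integral identity can
    be differentiated on the right for a fixed test function. *)
Lemma weak_expand (rho0 : Psphere R n) rho (phi : S -> R) G (t e : R) :
  weak_solution F rho0 rho -> C1_sgrad phi G -> 0 <= t -> 0 < e ->
  \forall h \near 0^'+,
    `|\int[rho (t + h)]_x phi x - \int[rho t]_x phi x -
      h * \int[rho t]_x dot (G x) (drift F x (rho t))| <= e * h.
Proof.
move=> [crho rho00 wrho] phiG t0 e0; have [cphi cG _] := phiG.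
have cM := continuous_F_curve crho.
pose I s := \int[rho (clamp s)]_x dot (G x) (drift F x (rho (clamp s))).
(* Stated for an arbitrary filter, to be used with time frozen and then jointly in time and
   space. *)
have cdr (T : Type) (FF : set_system T) (f : T -> S) (a : T -> R) y s :
    Filter FF ->
    f u @[u --> FF] --> y -> a u @[u --> FF] --> s ->
    dot (G (f u)) (drift F (f u) (rho (clamp (a u)))) @[u --> FF] -->
    dot (G y) (drift F y (rho (clamp s))).
  move=> fFF fy as_; under eq_fun do rewrite driftE; rewrite driftE.
  have fy' : sphere_val (f u) @[u --> FF] --> sphere_val y.
    by apply: (@cvg_comp _ _ _ f (@sphere_val R n) _ (nbhs y)) => //;
       exact: continuous_sphere_val.
  apply: cvg_dot.
    by apply: (@cvg_comp _ _ _ f G _ (nbhs y)) => //; exact: cG.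
  apply: cvg_tang => //; apply: cvg_mulmx => //.
  apply: (@cvg_comp _ _ _ a (fun t => F (rho (clamp t))) _ (nbhs s)) => //.
  exact: cM.
have cI : continuous I.
  move=> s; apply: cvg_Rintegral_curve => // [r y|y].
    by apply: (@cdr _ (nbhs y) id (fun=> r)); [exact: cvg_id|exact: cvg_cst].
  apply: (@cdr _ (nbhs (s, y)) snd fst); [exact: cvg_snd|exact: cvg_fst].
have rhoE r : 0 <= r -> \int[rho r]_x phi x = \int[rho0]_x phi x + prim I r.
  move=> r0; suff -> : prim I r = \int[rho r]_x phi x - \int[rho0]_x phi x.
    by rewrite addrC subrK.
  rewrite (wrho phi G phiG r r0) /prim r0; apply: eq_Rintegral => s.
  by rewrite inE/= in_itv/= => /andP[s0 _]; rewrite /I clampE.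
have := is_derive_expand e0 (is_derive_prim t cI).
move=> H; near=> h.
have h0 : 0 < h by near: h; exact: nbhs_right_gt.
have th0 : 0 <= t + h by rewrite addr_ge0// ltW.
rewrite !rhoE// -[h in e * h]gtr0_norm//.
have -> : \int[rho t]_x dot (G x) (drift F x (rho t)) = I t.
  by rewrite /I clampE.
rewrite (_ : _ - _ - _ = prim I (t + h) - prim I t - h *: I t); last first.
  by rewrite /GRing.scale/=; ring.
near: h; apply: cvg_within; exact: H.
Unshelve. all: by end_near. Qed.

(* Test functions transported backwards along the flow, f o N(B_t .) with
   B_t = Phi_t^-1, solve the dual transport equation, so that their integral
   against a weak solution does not depend on time. *)
Lemma transport_invariant (rho0 : Psphere R n) rho (B : R -> 'M[R]_n.+1) f g :
  weak_solution F rho0 rho -> B 0 = 1%:M ->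
  (forall t : R, is_derive t 1 B (- (B t *m F (rho (clamp t))))) ->
  (forall t, B t \in unitmx) -> has_gradient f g ->
  forall t, 0 <= t ->
    \int[rho t]_x f (sphere_val (nmap (B t) x)) =
    \int[rho0]_x f (sphere_val x).
Proof.
move=> wrho B0 dB uB fg; have [crho rho00 _] := wrho.
have [cf cg df] := fg.
pose M t := F (rho (clamp t)).
have cM : continuous M by exact: continuous_F_curve.
have cB : continuous B by move=> t; exact: is_derive_is_cvg (dB t).
pose z t x := sphere_val (nmap (B t) x).
pose u t (x : S) := f (z t x).
(* The adjoint of the differential of [nmap (B t)] applied to the gradient of [f]: this is the
   spherical gradient of [u t]. The function [w] below is the time derivative of [u]. *)
pose q t (x : S) := (enorm (B t *m sphere_val x))^-1 *:
  ((B t)^T *m tang (z t x) (g (z t x))).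
pose w t (x : S) := - dot (q t x) (M t *m sphere_val x).
have cz (T : Type) (FF : set_system T) (a : T -> R) (b : T -> S) s y :
    Filter FF ->
    a r @[r --> FF] --> s -> b r @[r --> FF] --> y ->
    z (a r) (b r) @[r --> FF] --> z s y.
  move=> fFF as_ by_.
  apply: (@cvg_comp _ _ _ (fun r => nmap (B (a r)) (b r)) (@sphere_val R n) _
    (nbhs (nmap (B s) y))); last exact: continuous_sphere_val.
  apply: cvg_nmap => //.
  by apply: (@cvg_comp _ _ _ a B _ (nbhs s)) => //; exact: cB.
have cu (T : Type) (FF : set_system T) (a : T -> R) (b : T -> S) s y :
    Filter FF ->
    a r @[r --> FF] --> s -> b r @[r --> FF] --> y ->
    u (a r) (b r) @[r --> FF] --> u s y.
  move=> fFF as_ by_.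
  apply: (@cvg_comp _ _ _ (fun r => z (a r) (b r)) f _ (nbhs (z s y))).
    exact: cz.
  exact: cf.
have cq (T : Type) (FF : set_system T) (a : T -> R) (b : T -> S) s y :
    Filter FF ->
    a r @[r --> FF] --> s -> b r @[r --> FF] --> y ->
    q (a r) (b r) @[r --> FF] --> q s y.
  move=> fFF as_ by_.
  have Bas : B (a r) @[r --> FF] --> B s.
    by apply: (@cvg_comp _ _ _ a B _ (nbhs s)) => //; exact: cB.
  have bv : sphere_val (b r) @[r --> FF] --> sphere_val y.
    by apply: (@cvg_comp _ _ _ b (@sphere_val R n) _ (nbhs y)) => //;
      exact: continuous_sphere_val.
  have zc := cz T FF a b s y fFF as_ by_.
  apply: cvgZ.
    apply: cvgV; first by rewrite enorm_eq0 unitmx_sphere_neq0.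
    by apply: cvg_enorm; exact: cvg_mulmx.
  apply: cvg_mulmx; first exact: cvg_trmx.
  apply: cvg_tang => //.
  apply: (@cvg_comp _ _ _ (fun r => z (a r) (b r)) g _ (nbhs (z s y))) => //.
  exact: cg.
have cw (T : Type) (FF : set_system T) (a : T -> R) (b : T -> S) s y :
    Filter FF ->
    a r @[r --> FF] --> s -> b r @[r --> FF] --> y ->
    w (a r) (b r) @[r --> FF] --> w s y.
  move=> fFF as_ by_; apply: cvgN; apply: cvg_dot; first exact: cq.
  apply: cvg_mulmx.
    by apply: (@cvg_comp _ _ _ a M _ (nbhs s)) => //; exact: cM.
  by apply: (@cvg_comp _ _ _ b (@sphere_val R n) _ (nbhs y)) => //;
      exact: continuous_sphere_val.
have ju (t : R) x : {for (t, x), continuous (fun p : R * S => u p.1 p.2)}.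
  by apply: (@cu _ (nbhs (t, x)) fst snd); [exact: cvg_fst|exact: cvg_snd].
have jw (t : R) x : {for (t, x), continuous (fun p : R * S => w p.1 p.2)}.
  by apply: (@cw _ (nbhs (t, x)) fst snd); [exact: cvg_fst|exact: cvg_snd].
have su t : continuous (u t).
  by move=> x; apply: (@cu _ (nbhs x) (fun=> t) id);
    [exact: cvg_cst|exact: cvg_id].
have sq t : continuous (q t).
  by move=> x; apply: (@cq _ (nbhs x) (fun=> t) id);
    [exact: cvg_cst|exact: cvg_id].
have sw t : continuous (w t).
  by move=> x; apply: (@cw _ (nbhs x) (fun=> t) id);
    [exact: cvg_cst|exact: cvg_id].
have qE t x v : dot (q t x) v =
    dot (g (z t x))
      ((enorm (B t *m sphere_val x))^-1 *: tang (z t x) (B t *m v)).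
  by rewrite /q dotZl -dot_trmx dot_tang dotZr.
have du x (t : R) : is_derive t 1 (u ^~ x) (w t x).
  apply: (is_derive_eq (df _ _ _ (is_derive_nmap (c := fun=> x) uB (dB t)
    (is_derive_cst _ t 1)))).
  rewrite mulmx0 addr0 /w qE mulNmx tangN scalerN dotNr.
  by rewrite mulmxA.
(* B x is parallel to the image point z, which the projection [tang z] annihilates. *)
have qorth t x : dot (sphere_val x) (q t x) = 0.
  rewrite dotC qE.
  have -> : B t *m sphere_val x = enorm (B t *m sphere_val x) *: z t x.
    rewrite /z nmapE// /normalize scalerA mulfV ?scale1r//.
    by rewrite enorm_eq0 unitmx_sphere_neq0.
  rewrite dotZr tangZ dotZr -dot_tang dotC dot_tang_orth ?mulr0//.
  exact: sphere_enorm.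
have uq t : C1_sgrad (u t) (q t).
  split => // x; split=> [|c v c0 dc]; first exact: qorth.
  have := df _ _ _ (is_derive_nmap (Phi := fun=> B t) (fun=> uB t)
    (is_derive_cst (B t) (0 : R) (1 : R)) dc).
  move=> H; apply: (is_derive_eq H).
  by rewrite c0 mul0mx add0r qE.
(* The dual transport equation: [q] is tangent, so it does not see the radial part of the drift, and
   what remains cancels the time derivative [w]. *)
have qdrift t x : 0 <= t -> dot (q t x) (drift F x (rho t)) = - w t x.
  move=> t0; rewrite driftE /tang dotDr dotNr dotZr.
  rewrite (dotC (q t x) (sphere_val x)).
  by rewrite qorth mulr0 subr0 /w opprK /M clampE.
pose W t := \int[rho (clamp t)]_x u t x.
have cW t : W s @[s --> t] --> W t by exact: cvg_Rintegral_curve.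
have ci r k : continuous k -> (rho r).-integrable [set: S] (EFin \o k).
  by move=> ck; exact: continuous_integrable_sphere.
(* Conservation is Gronwall's inequality with rate and initial gap 0. *)
suff WE t : 0 <= t -> `|W t - W 0| <= 0 * expR (0 * t).
  move=> t t0; have := WE t t0; rewrite mul0r normr_le0 subr_eq0 => /eqP.
  rewrite /W clampE// => ->; rewrite clampE//.
  rewrite (Rintegral_image (P := rho0) (f := id))//.
  by apply: eq_Rintegral => x _; rewrite /u /z B0 nmap1.
apply: (@gronwall _ (fun t => `|W t - W 0|) 0 0 0 0).
- move=> s _; apply: cvg_at_left_filter; apply: cvg_norm; apply: cvgB.
    exact: cW.
  exact: cvg_cst.
- move=> s e s0 e0; have e3 : 0 < e / 3 by rewrite divr_gt0.
  (* The function changes under rho(s + h) but the measure changes from rho(s); the first-order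
     terms cancel once the integrals of [w s] against these two measures are close. *)
  have H3n : \forall h \near (0 : R),
      `|\int[rho s]_x w s x - \int[rho (clamp (s + h))]_x w s x| <= e / 3.
    have : \int[rho (clamp r)]_x w s x @[r --> s] -->
        \int[rho (clamp s)]_x w s x.
      apply: (@cvg_Rintegral_curve _ _ rho (fun=> w s)) => // x.
      apply: (@cvg_comp _ _ _ snd (w s) _ (nbhs x)); first exact: cvg_snd.
      exact: sw.
    by move=> /cvgrPdist_le/(_ _ e3); rewrite clampE// => /near_addr.
  near=> h.
  have h0 : 0 < h by near: h; exact: nbhs_right_gt.
  have sh0 : 0 <= s + h by rewrite addr_ge0// ltW.
  have H1 x : `|u (s + h) x - u s x - h * w s x| <= e / 3 * `|h|.
    by move: x; near: h; apply: cvg_within; exact: unif_expand.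
  have H2 : `|\int[rho (s + h)]_x u s x - \int[rho s]_x u s x -
      h * \int[rho s]_x dot (q s x) (drift F x (rho s))| <= e / 3 * h.
    by near: h; exact: (weak_expand wrho (uq s) s0 e3).
  have H3 : `|\int[rho s]_x w s x - \int[rho (s + h)]_x w s x| <= e / 3.
    by rewrite -[s + h]clampE//; near: h; apply: cvg_within; exact: H3n.
  rewrite mul0r mul0r addr0 mulr0 addr0.
  rewrite gtr0_norm// in H1.
  have H4 : `|\int[rho (s + h)]_x u (s + h) x - \int[rho (s + h)]_x u s x -
      h * \int[rho (s + h)]_x w s x| <= e / 3 * h.
    by apply: normr_Rintegral_expand_le; [exact: ci..|].
  have H5 : \int[rho s]_x dot (q s x) (drift F x (rho s)) =
      - \int[rho s]_x w s x.
    rewrite -mulN1r -RintegralZl//; last exact: ci.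
    by apply: eq_Rintegral => x _; rewrite qdrift// mulN1r.
  rewrite H5 in H2.
  have -> : W (s + h) - W 0 = (W (s + h) - W s) + (W s - W 0) by rewrite subrKA.
  rewrite (le_trans (ler_normD _ _))// addrC lerD2l.
  rewrite /W !clampE//.
  exact: (split_increment_le h0 H2 H4 H3).
- by rewrite subrr normr0.
- by rewrite mul0r.
Unshelve. all: by end_near. Qed.

(** By [transport_invariant] and separation, the image of rho(t) under [nmap (B t)] is [rho0]; the
    inverse map [nmap (Phi t)] then carries [rho0] to rho(t). *)
Lemma weak_solution_flow (rho0 : Psphere R n) rho : weak_solution F rho0 rho ->
  exists Phi : R -> 'M[R]_n.+1,
    [/\ Phi 0 = 1%:M,
        forall t : R, is_derive t 1 Phi (F (rho (clamp t)) *m Phi t),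
        forall t, Phi t \in unitmx &
        forall t, 0 <= t -> forall A, measurable A ->
          rho t A = rho0 (nmap (Phi t) @^-1` A)].
Proof.
move=> wrho; have [crho _ _] := wrho.
have [Phi [B [Phi0 dPhi dB BPhi]]] := linear_flow (continuous_F_curve crho)
  (fun t => norm_F_le (rho (clamp t))).
have uB t : B t \in unitmx by have [] := mulmx1_unit (BPhi t).
have uPhi t : Phi t \in unitmx by have [] := mulmx1_unit (BPhi t).
exists Phi; split => // t t0 A mA.
have B0 : B 0 = 1%:M by rewrite -(BPhi 0) Phi0 mulmx1.
have eqB : measure_eq (distribution (rho t) (nmap (B t))) rho0.
  apply: measure_separation => f g fg.
  rewrite -(transport_invariant wrho B0 dB uB fg t0).
  have cf := has_gradient_sphere fg.
  by rewrite (Rintegral_image (P := rho t) (measurable_nmap (B t)) _ cf).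
rewrite -eqB; last by rewrite -[X in measurable X]setTI; exact: measurable_nmap.
rewrite /distribution /pushforward -comp_preimage; congr (rho t _).
have /nmapK K : Phi t *m B t = 1%:M by exact: mulmx1C (BPhi t).
by apply/seteqP; split => x /=; rewrite K.
Qed.

End MeanField.

(** * Comparison of flows *)

Section Flows.
Variables (R : realType) (n : nat).
Local Notation S := (sphere R n).
Local Notation curve := (R -> 'M[R]_n.+1).
Implicit Types (M Phi : curve) (t : R) (x y : S).

Definition is_flow M Phi :=
  [/\ continuous M, forall t, Phi t \in unitmx &
      forall t : R, is_derive t 1 Phi (M t *m Phi t)].

Definition velocity M Phi t x : 'cV[R]_n.+1 :=
  tang (sphere_val (nmap (Phi t) x)) (M t *m sphere_val (nmap (Phi t) x)).

Lemma is_derive_velocity M Phi t x : is_flow M Phi ->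
  is_derive t 1 (fun s => sphere_val (nmap (Phi s) x)) (velocity M Phi t x).
Proof. by move=> [_ uPhi dPhi]; exact: is_derive_flow. Qed.

Lemma cvg_flow M Phi (T : Type) (FF : set_system T) {fFF : Filter FF}
    (a : T -> R) (b : T -> S) t x : is_flow M Phi ->
  a r @[r --> FF] --> t -> b r @[r --> FF] --> x ->
  nmap (Phi (a r)) (b r) @[r --> FF] --> nmap (Phi t) x.
Proof.
move=> [cM uPhi dPhi] at_ bx; apply: cvg_nmap => //.
apply: (@cvg_comp _ _ _ a Phi _ (nbhs t)) => //.
exact: is_derive_is_cvg (dPhi t).
Qed.

Lemma cvg_flow_val M Phi (T : Type) (FF : set_system T) {fFF : Filter FF}
    (a : T -> R) (b : T -> S) t x : is_flow M Phi ->
  a r @[r --> FF] --> t -> b r @[r --> FF] --> x ->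
  sphere_val (nmap (Phi (a r)) (b r)) @[r --> FF] -->
  sphere_val (nmap (Phi t) x).
Proof.
move=> MPhi at_ bx.
apply: (@cvg_comp _ _ _ (fun r => nmap (Phi (a r)) (b r)) (@sphere_val R n) _
  (nbhs (nmap (Phi t) x))); last exact: continuous_sphere_val.
exact: (cvg_flow MPhi).
Qed.

Lemma cvg_velocity M Phi (T : Type) (FF : set_system T) {fFF : Filter FF}
    (a : T -> R) (b : T -> S) t x : is_flow M Phi ->
  a r @[r --> FF] --> t -> b r @[r --> FF] --> x ->
  velocity M Phi (a r) (b r) @[r --> FF] --> velocity M Phi t x.
Proof.
move=> MPhi at_ bx.
have zc : sphere_val (nmap (Phi (a r)) (b r)) @[r --> FF] -->
    sphere_val (nmap (Phi t) x) by exact: (cvg_flow_val MPhi).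
apply: (cvg_tang zc); apply: cvg_mulmx; last exact: zc.
have [cM _ _] := MPhi.
by apply: (@cvg_comp _ _ _ a M _ (nbhs t)) => //; exact: cM.
Qed.

(** The scale [k] is |h| for first-order expansions and 1 for uniform continuity. *)
Lemma near_enorm_le (T : Type) (FF : set_system T) {fFF : Filter FF}
    (v : T -> S -> 'cV[R]_n.+1) (k : T -> R) :
  (forall e, 0 < e -> forall i,
     \forall r \near FF, forall x, `|v r x i 0| <= e * k r) ->
  forall e, 0 < e -> \forall r \near FF, forall x, enorm (v r x) <= e * k r.
Proof.
move=> H e e0; have en : 0 < e / n.+1%:R by rewrite divr_gt0.
have : \forall r \near FF, forall i x, `|v r x i 0| <= e / n.+1%:R * k r.
  by apply: filter_forall => i; exact: H.
apply: filterS => r Hr x; rewrite (le_trans (enorm_le_sum _))//.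
rewrite (le_trans (ler_sum _ (fun i _ => Hr i x)))//.
rewrite sumr_const card_ord -[leLHS]mulr_natr.
by rewrite -[leLHS]mulrA (mulrC (k r)) mulrA divfK.
Qed.

Lemma flow_expand M Phi t : is_flow M Phi -> forall e, 0 < e ->
  \forall h \near (0 : R), forall x,
    enorm (sphere_val (nmap (Phi (t + h)) x) - sphere_val (nmap (Phi t) x)
      - h *: velocity M Phi t x) <= e * `|h|.
Proof.
move=> MPhi; apply: (@near_enorm_le _ (nbhs (0 : R)) _
  (fun h x => sphere_val (nmap (Phi (t + h)) x) - sphere_val (nmap (Phi t) x)
    - h *: velocity M Phi t x) (fun h => `|h|)) => e e0 i.
have : \forall h \near (0 : R), forall x,
    `|sphere_val (nmap (Phi (t + h)) x) i 0 - sphere_val (nmap (Phi t) x) i 0 -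
      h * velocity M Phi t x i 0| <= e * `|h|.
  apply: (@unif_expand _ _ (fun t x => sphere_val (nmap (Phi t) x) i 0)
    (fun t x => velocity M Phi t x i 0)) => // [x s|x].
    by have /is_derive_mxP := is_derive_velocity s x MPhi; apply.
  have : velocity M Phi p.1 p.2 @[p --> (t, x)] --> velocity M Phi t x.
    by apply: (cvg_velocity MPhi); [exact: cvg_fst|exact: cvg_snd].
  by move=> /cvg_mxP; apply.
apply: filterS => h H x; have := H x.
by move: (velocity _ _ _ _) => v; rewrite !mxE.
Qed.

Lemma flow_unif M Phi t : is_flow M Phi -> forall e, 0 < e ->
  \forall s \near t, forall x,
    enorm (sphere_val (nmap (Phi s) x) - sphere_val (nmap (Phi t) x)) <= e.
Proof.
move=> MPhi e e0.
suff : \forall s \near t, forall x,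
    enorm (sphere_val (nmap (Phi s) x) - sphere_val (nmap (Phi t) x)) <= e * 1.
  by rewrite mulr1.
apply: (@near_enorm_le _ (nbhs t) _
  (fun s x => sphere_val (nmap (Phi s) x) - sphere_val (nmap (Phi t) x))
  (fun=> 1)) => // {}e {}e0 i.
have : \forall s \near t, forall x,
    `|sphere_val (nmap (Phi s) x) i 0 - sphere_val (nmap (Phi t) x) i 0| <= e.
  apply: (@unif_cvg _ _ _
    (fun p : R * S => sphere_val (nmap (Phi p.1) p.2) i 0)) => // x.
  have : sphere_val (nmap (Phi p.1) p.2) @[p --> (t, x)] -->
      sphere_val (nmap (Phi t) x).
    by apply: (cvg_flow_val MPhi); [exact: cvg_fst|exact: cvg_snd].
  by move=> /cvg_mxP; apply.
by apply: filterS => s H x; rewrite !mxE mulr1; exact: H.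
Qed.

Lemma increment_dist (a a' b b' va vb : 'cV[R]_n.+1) (h e1 e2 K : R) : 0 <= h ->
  enorm (a' - a - h *: va) <= e1 -> enorm (b' - b - h *: vb) <= e2 ->
  enorm (va - vb) <= K ->
  enorm (a' - b') <= enorm (a - b) + h * K + (e1 + e2).
Proof.
move=> h0 H1 H2 H3.
have -> : a' - b' = (a - b) + h *: (va - vb) +
    ((a' - a - h *: va) - (b' - b - h *: vb)).
  by apply/colP => i; rewrite !mxE; ring.
rewrite (le_trans (ler_enormD _ _))// lerD//.
  rewrite (le_trans (ler_enormD _ _))// lerD2l enormZ ger0_norm//.
  by rewrite ler_wpM2l.
by rewrite (le_trans (ler_enormB _ _))// lerD.
Qed.

Section FlowGronwall.
Context {d : measure_display} {T : measurableType d}.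
Variables (P : probability T R) (f0 g0 : T -> S).
Hypothesis mf0 : measurable_fun [set: T] f0.
Hypothesis mg0 : measurable_fun [set: T] g0.
Variables M M' Phi Phi' : curve.
Hypothesis MPhi : is_flow M Phi.
Hypothesis MPhi' : is_flow M' Phi'.

(** The transport cost of a random pair moved by two flows. Stability takes [P] a coupling with its
    two projections; existence takes [P = rho0] with both starting maps the identity. *)
Definition flow_gap t : R :=
  \int[P]_z dist (nmap (Phi t) \o f0) (nmap (Phi' t) \o g0) z.

Let mPhi t : measurable_fun [set: T] (nmap (Phi t) \o f0).
Proof. by apply: measurableT_comp => //; exact: measurable_nmap. Qed.

Let mPhi' t : measurable_fun [set: T] (nmap (Phi' t) \o g0).
Proof. by apply: measurableT_comp => //; exact: measurable_nmap. Qed.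

Lemma cvg_flow_gap t : flow_gap s @[s --> t] --> flow_gap t.
Proof.
apply/cvgrPdist_le => e e0; have e2 : 0 < e / 2 by rewrite divr_gt0.
apply: filterS2 (flow_unif t MPhi e2) (flow_unif t MPhi' e2) => s H1 H2.
rewrite distrC; apply: normr_RintegralB_le; [exact: integrable_dist..|].
move=> z; rewrite (le_trans (ler_distB_enorm _ _ _ _))//.
by rewrite (splitr e) lerD//; [exact: H1|exact: H2].
Qed.

(** The difference of the fields is allowed a part controlled by the gap itself and an external
    part. Stability uses [Lc = L] and [K = 0], the contraction uses [Lc = 0] and [K] proportional to
    the distance of the two curves. *)
Lemma flow_gronwall (C Lc K lam A : R) : 0 <= C ->
  (forall t v, 0 <= t -> enorm (M t *m v) <= C * enorm v) ->
  (forall t y, 0 <= t -> enorm ((M t - M' t) *m sphere_val y) <=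
     Lc * flow_gap t + K * expR (lam * t)) ->
  flow_gap 0 <= A -> K <= A * (lam - (3 * C + Lc)) ->
  forall t, 0 <= t -> flow_gap t <= A * expR (lam * t).
Proof.
move=> C0 MC MM' D0 KA; apply: (@gronwall _ _ (3 * C + Lc) lam K) => //.
  by move=> t _; apply: cvg_at_left_filter; exact: cvg_flow_gap.
move=> t e t0 e0; have e2 : 0 < e / 2 by rewrite divr_gt0.
have n1 := near_right (flow_expand t MPhi e2).
have n2 := near_right (flow_expand t MPhi' e2).
apply: filterS3 n1 n2 (nbhs_right_gt 0) => h H1 H2 h0.
rewrite gtr0_norm// in H1 H2.
pose dl := Lc * flow_gap t + K * expR (lam * t).
have -> : flow_gap t +
    h * ((3 * C + Lc) * flow_gap t + K * expR (lam * t)) + e * h =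
  (1 + h * (3 * C)) * flow_gap t + (h * dl + e * h) by rewrite /dl; ring.
apply: Rintegral_le_affine; [exact: integrable_dist..|].
move=> z; rewrite /dist /=.
have H3 := tang_lipschitz (M' t) C0 (fun v => MC t v t0)
  (sphere_enorm (nmap (Phi t) (f0 z))) (sphere_enorm (nmap (Phi' t) (g0 z))).
have {}H3 := le_trans H3 (lerD (lexx _) (MM' t (nmap (Phi' t) (g0 z)) t0)).
have := increment_dist (ltW h0) (H1 (f0 z)) (H2 (g0 z)) H3.
rewrite -/dl => /le_trans; apply.
move: (enorm (sphere_val (nmap (Phi t) (f0 z)) - _)) => r; clearbody dl.
rewrite [leRHS](_ : _ = r + h * (3 * C * r + dl) + (e / 2 * h + e / 2 * h))//.
by field.
Qed.

End FlowGronwall.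

End Flows.

(** * Uniqueness, stability and existence *)

Section OneSidedDerivatives.
Variables (R : realType) (m : nat).
Implicit Types (f : R -> 'cV[R]_m) (v : 'cV[R]_m) (t : R).

Lemma norm_le_enorm v : `|v| <= enorm v.
Proof.
apply: norm_le_coord => [|i j]; first exact: enorm_ge0.
by rewrite ord1 coord_le_enorm.
Qed.

Lemma is_derive_within f t v (D : set R) : is_derive t 1 f v ->
  (s - t)^-1 *: (f s - f t) @[s --> within D t^'] --> v.
Proof.
move=> fv; apply/cvgrPdist_le => e e0.
rewrite near_withinE near_withinE.
have : \forall h \near t - t, `|f (t + h) - f t - h *: v| <= e * `|h|.
  by rewrite subrr; exact: is_derive_expand.
move=> H.
have {H} : \forall s \near t, `|f s - f t - (s - t) *: v| <= e * `|s - t|.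
  have c : s - t @[s --> t] --> t - t.
    by apply: cvgB; [exact: cvg_id|exact: cvg_cst].
  have K : \forall s \near t,
      `|f (t + (s - t)) - f t - (s - t) *: v| <= e * `|s - t| := c _ H.
  by apply: filterS K => s; rewrite (addrC t) subrK.
apply: filterS => s H st _; have st0 : s - t != 0 by rewrite subr_eq0.
have -> : v - (s - t)^-1 *: (f s - f t) =
    - ((s - t)^-1 *: (f s - f t - (s - t) *: v)).
  by rewrite [in RHS]scalerBr scalerA mulVf// scale1r opprB.
by rewrite normrN normrZ normfV ler_pdivrMl ?normr_gt0// mulrC.
Qed.

Lemma within_expand f t v (D : set R) :
  (s - t)^-1 *: (f s - f t) @[s --> within D t^'] --> v ->
  forall e, 0 < e -> \forall s \near t, D s ->
    enorm (f s - f t - (s - t) *: v) <= e * `|s - t|.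
Proof.
(* Passing from the max norm to the Euclidean norm costs a factor [m]; the successor avoids dividing
   by 0. *)
move=> + e e0; have em : 0 < e / m.+1%:R by rewrite divr_gt0.
move=> /cvgrPdist_le/(_ _ em); rewrite near_withinE near_withinE.
apply: filterS => s H Ds; have [->|st] := eqVneq s t.
  by rewrite !subrr scale0r subrr enorm0 normr0 mulr0.
have st0 : s - t != 0 by rewrite subr_eq0.
have {}H := H st Ds.
have -> : f s - f t - (s - t) *: v =
    - ((s - t) *: (v - (s - t)^-1 *: (f s - f t))).
  by rewrite scalerBr scalerA divff// scale1r opprB.
rewrite enormN enormZ mulrC ler_wpM2r// (le_trans (enorm_le_norm _))//.
rewrite (le_trans (ler_wpM2l (ler0n _ m) H))//.
by rewrite mulrCA ler_piMr ?(ltW e0)// ler_pdivrMr// mul1r ler_nat.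
Qed.

(** [is_sgrad] tests curves through the point at time 0, so flow lines have to be retimed. *)
Lemma is_derive_shift f t v : is_derive t 1 f v ->
  is_derive (0 : R) 1 (fun s => f (s + t)) v.
Proof.
move=> /is_derive_mxP fv; apply/is_derive_mxP => i j.
have ft : is_derive (0 + t) 1 (fun s => f s i j) (v i j) by rewrite add0r.
rewrite -[v i j]mulr1; apply: (is_derive_chain (g := fun s => s + t) ft).
apply: (is_derive_eq (is_deriveD (is_derive_id (0 : R) (1 : R))
  (is_derive_cst t (0 : R) (1 : R)))).
by rewrite addr0.
Qed.

End OneSidedDerivatives.

Lemma ler_increment_diff (R : numDomainType) (j0 j1 p0 p1 i c e1 e2 : R) :
  `|j1 - j0 - i| <= e1 -> `|p1 - p0 - i| <= e2 ->
  `|j1 - c - p1| <= `|j0 - c - p0| + (e1 + e2).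
Proof.
move=> H1 H2.
have -> : j1 - c - p1 = (j0 - c - p0) + ((j1 - j0 - i) - (p1 - p0 - i)) by ring.
rewrite (le_trans (ler_normD _ _))// lerD2l (le_trans (ler_normB _ _))//.
exact: lerD.
Qed.

Section MeanFieldFlow.
Variables (R : realType) (n : nat) (F : Psphere R n -> 'M[R]_n.+1) (L : R).
Local Notation S := (sphere R n).
Implicit Types (mu nu : Psphere R n) (rho : R -> Psphere R n).
Hypothesis L_ge0 : 0 <= L.
Hypothesis F_lip : forall mu nu,
  ((opnorm (F mu - F nu))%:E <= L%:E * W1 mu nu)%E.

Lemma velocityE rho Phi (t : R) x : 0 <= t ->
  velocity (fun t => F (rho (clamp t))) Phi t x =
  drift F (nmap (Phi t) x) (rho t).
Proof. by move=> t0; rewrite driftE /velocity clampE. Qed.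

Lemma char_flow_nmap rho Phi : Phi 0 = 1%:M ->
  is_flow (fun t => F (rho (clamp t))) Phi ->
  char_flow F rho (fun t => nmap (Phi t)).
Proof.
move=> Phi0 MPhi x; split=> [|t t0]; first by rewrite Phi0 nmap1.
rewrite -velocityE//.
apply: (is_derive_within (f := fun s => sphere_val (nmap (Phi s) x))).
exact: is_derive_velocity.
Qed.

(** The distance r of two characteristics driven by the same curve satisfies D^+ r <= 3 C r and
    starts at 0. *)
Lemma char_flow_unique rho Phi Psi : Phi 0 = 1%:M ->
  is_flow (fun t => F (rho (clamp t))) Phi -> char_flow F rho Psi ->
  forall t, 0 <= t -> Psi t = nmap (Phi t).
Proof.
move=> Phi0 MPhi PsiE t t0; apply/funext => x; apply: sphere_val_inj.
have C0 := CF_ge0 L_ge0 F_lip.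
apply/eqP; rewrite -subr_eq0 -enorm_eq0 eq_le enorm_ge0 andbT.
pose r s := enorm (sphere_val (Psi s x) - sphere_val (nmap (Phi s) x)).
suff : r t <= 0 * expR (3 * CF F * t) by rewrite mul0r.
have [Psi0 dPsi] := PsiE x.
apply: (@gronwall _ r (3 * CF F) (3 * CF F) 0 0) => //.
- move=> s s0; apply: cvg_enorm; apply: cvgB; last first.
    apply: cvg_at_left_filter.
    exact: is_derive_is_cvg (is_derive_velocity s x MPhi).
  have H := within_expand (dPsi s (ltW s0)) ltr01.
  set v := drift _ _ _ in H.
  (* [Psi] is known only through its difference quotients; near [s] they give |Psi z - Psi s| <= (1
     + |v|) |z - s|, hence left continuity. *)
  have c : (1 + enorm v) * `|z - s| @[z --> s] --> (1 + enorm v) * `|s - s|.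
    apply: cvgM; first exact: cvg_cst.
    by apply: cvg_norm; apply: cvgB; [exact: cvg_id|exact: cvg_cst].
  rewrite subrr normr0 mulr0 in c.
  apply: cvg_at_left_filter.
  apply/cvgrPdist_le => e e0.
  apply: filterS3 H (cvgr_le _ c _ e0) (lt_nbhsr s0) => z H ce z0.
  rewrite distrC (le_trans (norm_le_enorm _))// (le_trans _ ce)//.
  have := ler_enormD
    (sphere_val (Psi z x) - sphere_val (Psi s x) - (z - s) *: v) ((z - s) *: v).
  rewrite subrK enormZ => /le_trans; apply.
  by rewrite mulrDl lerD// ?(H (ltW z0))// mulrC.
- move=> s e s0 e0; have e2 : 0 < e / 2 by rewrite divr_gt0.
  have n1 := near_right (flow_expand s MPhi e2).
  have n2 := near_right (near_addr (within_expand (dPsi s s0) e2)).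
  apply: filterS3 n1 n2 (nbhs_right_gt 0) => h H1 H2 h0.
  have {}H2 := H2 (addr_ge0 s0 (ltW h0)).
  have sh : s + h - s = h by rewrite addrAC subrr add0r.
  rewrite sh gtr0_norm// in H2.
  have {}H1 := H1 x; rewrite velocityE// gtr0_norm// in H1.
  have H3 := tang_lipschitz (F (rho s)) C0
    (fun v => enorm_F_le L_ge0 F_lip (rho s) v)
    (sphere_enorm (Psi s x)) (sphere_enorm (nmap (Phi s) x)).
  rewrite subrr mul0mx enorm0 addr0 -!driftE in H3.
  rewrite (le_trans (increment_dist (ltW h0) H2 H1 H3))// -/(r s).
  rewrite [leRHS](_ : _ =
    r s + h * (3 * CF F * r s) + (e / 2 * h + e / 2 * h))//.
  by field.
- by rewrite /r Psi0 Phi0 nmap1 subrr enorm0.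
- by rewrite subrr mulr0.
Qed.

Lemma stability (rho0 rho0' : Psphere R n) rho rho' (t : R) :
  weak_solution F rho0 rho -> weak_solution F rho0' rho' -> 0 <= t ->
  (W1 (rho t) (rho' t) <= (expR ((3 * CF F + L) * t))%:E * W1 rho0 rho0')%E.
Proof.
move=> wrho wrho' t0; have C0 := CF_ge0 L_ge0 F_lip.
have [Phi [Phi0 dPhi uPhi rhoE]] := weak_solution_flow L_ge0 F_lip wrho.
have [Phi' [Phi0' dPhi' uPhi' rhoE']] := weak_solution_flow L_ge0 F_lip wrho'.
have [crho _ _] := wrho; have [crho' _ _] := wrho'.
have MPhi : is_flow (fun t => F (rho (clamp t))) Phi.
  by split => //; exact: continuous_F_curve L_ge0 F_lip _ crho.
have MPhi' : is_flow (fun t => F (rho' (clamp t))) Phi'.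
  by split => //; exact: continuous_F_curve L_ge0 F_lip _ crho'.
(* With the exponential on the left, the bound can be proved for each coupling separately. *)
rewrite -lee_pdivrMl ?expR_gt0//; apply: le_ereal_inf_tmp => _ [pi cpi <-].
rewrite (coupling_dist cpi) lee_pdivrMl ?expR_gt0// -EFinM.
have m1 : measurable_fun [set: S * S] fst by exact: measurable_fst.
have m2 : measurable_fun [set: S * S] snd by exact: measurable_snd.
(* The gap dominates [W1] at every time, so the Lipschitz bound on [F] is at most L times the gap
   and Gronwall closes on the gap alone. *)
have W1D s : 0 <= s ->
    (W1 (rho s) (rho' s) <= (flow_gap pi fst snd Phi Phi' s)%:E)%E.
  move=> s0; apply: W1_le_dist.
  - by apply: measurableT_comp => //; exact: measurable_nmap.
  - by apply: measurableT_comp => //; exact: measurable_nmap.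
  - move=> A mA; rewrite rhoE// comp_preimage.
    have mA' : measurable (nmap (Phi s) @^-1` A).
      by rewrite -[X in measurable X]setTI; exact: measurable_nmap.
    by have [-> _] := cpi _ mA'.
  - move=> A mA; rewrite rhoE'// comp_preimage.
    have mA' : measurable (nmap (Phi' s) @^-1` A).
      by rewrite -[X in measurable X]setTI; exact: measurable_nmap.
    by have [_ ->] := cpi _ mA'.
rewrite (le_trans (W1D t t0))// lee_fin mulrC.
have -> : \int[pi]_z dist fst snd z = flow_gap pi fst snd Phi Phi' 0.
  by apply: eq_Rintegral => z _; rewrite /dist /= Phi0 Phi0' !nmap1.
apply: (flow_gronwall m1 m2 MPhi MPhi' (C := CF F) (Lc := L) (K := 0)) => //.
- by move=> s v _; exact: enorm_F_le L_ge0 F_lip _ _.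
- move=> s y s0; rewrite mul0r addr0 !clampE//.
  rewrite (le_trans (enorm_mulmx _ _))// sphere_enorm mulr1.
  exact: opnormB_le L_ge0 F_lip _ _ _ (W1D s s0).
- by rewrite subrr mulr0.
Qed.

Lemma flow_W1_continuous (rho0 : Psphere R n) M Phi : is_flow M Phi ->
  W1_continuous (fun t => distribution rho0 (nmap (Phi t)) : Psphere R n).
Proof.
move=> MPhi t t0; apply: cvg_within_filter.
have H e : 0 < e -> \forall s \near t,
    (W1 (distribution rho0 (nmap (Phi s)) : Psphere R n)
        (distribution rho0 (nmap (Phi t)) : Psphere R n) <= e%:E)%E.
  move=> e0; apply: filterS (flow_unif t MPhi e0) => s H.
  rewrite (le_trans (W1_le_dist (P := rho0) (measurable_nmap (Phi s))
    (measurable_nmap (Phi t)) _ _))// lee_fin.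
  apply: Rintegral_le_cst; last exact: H.
  by apply: integrable_dist; exact: measurable_nmap.
apply/fine_cvgP; split.
  apply: filterS (H 1 ltr01) => s H1.
  by rewrite ge0_fin_numE ?W1_ge0// (le_lt_trans H1)// ltry.
apply/cvgrPdist_le => e e0; apply: filterS (H e e0) => s Hs /=.
rewrite sub0r normrN ger0_norm ?fine_ge0 ?W1_ge0//.
by rewrite -lee_fin fineK// ge0_fin_numE ?W1_ge0// (le_lt_trans Hs)// ltry.
Qed.

Section Pushforward.
Variables (rho0 : Psphere R n) (rho : R -> Psphere R n) (Phi : R -> 'M[R]_n.+1).
Hypothesis Phi0 : Phi 0 = 1%:M.
Hypothesis MPhi : is_flow (fun t => F (rho (clamp t))) Phi.
Hypothesis rhoE : forall t, rho t = distribution rho0 (nmap (Phi t)).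

Let Rint_rho t (psi : S -> R) : continuous psi ->
  \int[rho t]_x psi x = \int[rho0]_x psi (nmap (Phi t) x).
Proof.
move=> cpsi.
apply: (Rintegral_image (P := rho0) (measurable_nmap (Phi t))) => //.
by move=> A mA; rewrite rhoE.
Qed.

(** After a change of variables the time derivative falls on phi along the flow lines, where it is
    given by the spherical gradient. *)
Lemma pushforward_weak_solution : weak_solution F rho0 rho.
Proof.
have crho : W1_continuous rho.
  rewrite (_ : rho = fun t => distribution rho0 (nmap (Phi t))).
    exact: flow_W1_continuous MPhi.
  exact/funext.
split => //.
  by move=> A mA; rewrite rhoE Phi0 /distribution /pushforward /=; congr (rho0 _);
    apply/seteqP; split => x /=; rewrite nmap1.
move=> phi G phiG t t0; have [cphi cG sG] := phiG.
pose M s := F (rho (clamp s)).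
pose w s x := dot (G (nmap (Phi s) x)) (velocity M Phi s x).
have cw (T : Type) (FF : set_system T) (a : T -> R) (b : T -> S) s y :
    Filter FF ->
    a r @[r --> FF] --> s -> b r @[r --> FF] --> y ->
    w (a r) (b r) @[r --> FF] --> w s y.
  move=> fFF as_ by_; apply: cvg_dot; last exact: (cvg_velocity MPhi).
  apply: (@cvg_comp _ _ _ (fun r => nmap (Phi (a r)) (b r)) G _
    (nbhs (nmap (Phi s) y))).
    exact: (cvg_flow MPhi).
  exact: cG.
have jw s x : {for (s, x), continuous (fun p : R * S => w p.1 p.2)}.
  by apply: (@cw _ (nbhs (s, x)) fst snd); [exact: cvg_fst|exact: cvg_snd].
have sw s : continuous (w s).
  by move=> x; apply: (@cw _ (nbhs x) (fun=> s) id);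
    [exact: cvg_cst|exact: cvg_id].
have dphi x (s : R) : is_derive s 1 (fun r => phi (nmap (Phi r) x)) (w s x).
  have [_ sGx] := sG (nmap (Phi s) x).
  have dc := is_derive_shift (f := fun r => sphere_val (nmap (Phi r) x))
    (is_derive_velocity s x MPhi).
  have := sGx (fun r => nmap (Phi (r + s)) x) _ _ dc.
  rewrite add0r => /(_ erefl) d.
  rewrite -[w s x]mulr1.
  have d' : is_derive (s - s) 1 (fun r => phi (nmap (Phi (r + s)) x)) (w s x).
    by rewrite subrr.
  apply: (is_derive_ext _ (is_derive_chain (g := fun r => r - s) d'
    (is_derive_eq (is_deriveB (is_derive_id s 1) (is_derive_cst s s 1))
      (subr0 1)))).
  by move=> r; rewrite subrK.
pose I s := \int[rho0]_x w (clamp s) x.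
have ci k : continuous k -> rho0.-integrable [set: S] (EFin \o k).
  by move=> ck; exact: continuous_integrable_sphere.
have cI : continuous I.
  move=> s; apply/cvgrPdist_le => e e0.
  have H := unif_cvg e0 (jw (clamp s)).
  have {}H : \forall r \near s, forall x, `|w (clamp r) x - w (clamp s) x| <= e.
    by move: (@continuous_clamp R s) => /(_ _ H).
  apply: filterS H => r H.
  rewrite distrC; apply: normr_RintegralB_le; [exact: ci..|exact: H].
have IE s : 0 <= s -> \int[rho s]_x dot (G x) (drift F x (rho s)) = I s.
  move=> s0; rewrite Rint_rho.
    by apply: eq_Rintegral => x _; rewrite /w velocityE// clampE.
  move=> x; apply: (@cvg_dot _ _ (nbhs x) _ _ G); first exact: cG.
  under eq_fun do rewrite driftE; rewrite driftE.
  have cv := @continuous_sphere_val R n x.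
  apply: (@cvg_tang _ _ _ (nbhs x)); first exact: cv.
  by apply: (@cvg_mulmx _ _ (nbhs x)); [exact: cvg_cst|exact: cv].
pose J s := \int[rho0]_x phi (nmap (Phi s) x).
have cphiJ s : continuous (fun x => phi (nmap (Phi s) x)).
  move=> x.
  apply: (@cvg_comp _ _ _ (nmap (Phi s)) phi _ (nbhs (nmap (Phi s) x))).
    exact: continuous_nmap.
  exact: cphi.
have J0 : \int[rho0]_x phi x = J 0.
  by apply: eq_Rintegral => x _; rewrite Phi0 nmap1.
rewrite Rint_rho// J0 -/(J t).
transitivity (prim I t); last first.
  rewrite /prim t0; apply: eq_Rintegral => s.
  by rewrite inE/= in_itv/= => /andP[s0 _]; rewrite IE.
have dJ s e : 0 <= s -> 0 < e -> \forall h \near (0 : R),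
    `|J (s + h) - J s - h * I s| <= e * `|h|.
  move=> s0 e0; rewrite /I clampE//.
  have := @unif_expand _ _ (fun r x => phi (nmap (Phi r) x)) w s e e0 dphi
    (jw s).
  apply: filterS => h H.
  by apply: normr_Rintegral_expand_le; [exact: ci..|exact: H].
apply/eqP; rewrite -subr_eq0 -normr_le0.
(* [J - J 0] and [prim I] have the same first-order increments, so Gronwall with rate 0 identifies
   them. *)
pose r (s : R) : R := `|J s - J 0 - prim I s|.
suff : r t <= 0 * expR (0 * t) by rewrite mul0r.
have dp s := is_derive_prim s cI.
apply: (@gronwall _ r 0 0 0 0) => //.
- move=> s s0; apply: cvg_at_left_filter; apply: cvg_norm.
  apply: cvgB; last first.
    exact: is_derive_is_cvg (dp s).
  apply: cvgB; last exact: cvg_cst.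
  apply/cvgrPdist_le => e e0.
  have jphi x :
      {for (s, x), continuous (fun p : R * S => phi (nmap (Phi p.1) p.2))}.
    apply: (@cvg_comp _ _ _ (fun p => nmap (Phi p.1) p.2) phi _
      (nbhs (nmap (Phi s) x))).
      apply: (cvg_flow (FF := nbhs (s, x)) MPhi).
        exact: cvg_fst.
      exact: cvg_snd.
    exact: cphi.
  apply: filterS (unif_cvg e0 jphi) => z H.
  by rewrite distrC; apply: normr_RintegralB_le; [exact: ci..|exact: H].
- move=> s e s0 e0; have e2 : 0 < e / 2 by rewrite divr_gt0.
  have n1 := near_right (dJ s _ s0 e2).
  have n2 := near_right (is_derive_expand e2 (dp s)).
  apply: filterS3 n1 n2 (nbhs_right_gt 0) => h H1 H2 h0.
  rewrite (gtr0_norm h0) in H1 H2.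
  rewrite !mul0r addr0 mulr0 addr0 (splitr e) mulrDl.
  exact: ler_increment_diff H1 H2.
- by rewrite /r prim0// subrr subr0 normr0.
Qed.

End Pushforward.

Lemma mean_field_flow_exists (rho0 : Psphere R n) :
  exists2 Phi : R -> 'M[R]_n.+1, Phi 0 = 1%:M &
    is_flow (fun t => F (distribution rho0 (nmap (Phi (clamp t))))) Phi.
Proof.
have C0 := CF_ge0 L_ge0 F_lip; set C := CF F in C0.
(* The Euclidean bound is carried along the iteration: it gives the exact constant [C] in
   [flow_gronwall], it bounds the entries for [linear_flow], and being closed it passes to the
   limit. *)
pose Q := [set A : 'M[R]_n.+1 | forall v, enorm (A *m v) <= C * enorm v].
have cQ : closed Q.
  rewrite (_ : Q =
    \bigcap_v [set A : 'M[R]_n.+1 | enorm (A *m v) <= C * enorm v]).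
    apply: closed_bigI => v _.
    rewrite (_ : mkset _ = (fun A : 'M[R]_n.+1 => enorm (A *m v)) @^-1`
      [set y | y <= C * enorm v])//.
    apply: preimage_closed; last exact: closed_le.
    move=> A _; apply: (@cvg_enorm _ _ (nbhs A) _ _ (fun A => A *m v)).
    by apply: (@cvg_mulmx _ _ (nbhs A)); [exact: cvg_id|exact: cvg_cst].
  by apply/seteqP; split => A /= H v => [_|]; exact: H.
have QC A : Q A -> `|A| <= C.
  by move=> QA; rewrite (le_trans (norm_le_opnorm _))// opnorm_le.
have QF mu : Q (F mu) by move=> v; exact: (enorm_F_le L_ge0 F_lip).
(* The premise sits inside the existential so that choice yields a map defined on every curve, with
   a constant junk value on inadmissible ones. *)
have ex M : exists Phi : R -> 'M[R]_n.+1, (continuous M /\ forall t, Q (M t)) ->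
    Phi 0 = 1%:M /\ is_flow M Phi.
  have [[cM QM]|nM] := pselect (continuous M /\ forall t, Q (M t)); last first.
    by exists (fun=> 1%:M) => /nM.
  have [Phi [B [Phi0 dPhi _ BPhi]]] := linear_flow cM (fun t => QC _ (QM t)).
  exists Phi => _; split=> //; split=> // t.
  by have [] := mulmx1_unit (BPhi t).
have /choice[Ph HPh] := ex.
pose rhoM M t : Psphere R n := distribution rho0 (nmap (Ph M t)).
pose T M t := F (rhoM M (clamp t)).
pose c : R := n.+1%:R * n.+1%:R.
have c0 : 0 <= c by rewrite mulr_ge0.
(* The excess over the rate 3 C is [2 * (L * c) + 1], where [c] converts entrywise into Euclidean
   bounds. The gap is then at most [c * D] over this excess, up to the weight, and [L] times it is
   at most D / 2. *)
pose lam := 3 * C + (2 * (L * c) + 1).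
have Lc0 : 0 <= L * c by rewrite mulr_ge0.
have lam3 : lam - (3 * C + 0) = 2 * (L * c) + 1 by rewrite /lam; ring.
have lam0 : 0 < lam by rewrite /lam; lra.
have [|||||M [cM QM] TM] := @weighted_fixpoint R _ _ Q T lam (2 * C)
  (fun=> F rho0) cQ.
- move=> M PM; have [_ MPhi] := HPh M PM; split; last by move=> t; exact: QF.
  exact: (continuous_F_curve L_ge0 F_lip (flow_W1_continuous rho0 MPhi)).
- move=> M M' D PM PM' D0 MM' t.
  have [Phi0 MPhi] := HPh M PM; have [Phi0' MPhi'] := HPh M' PM'.
  have s0 := clamp_ge0 t; set s := clamp t in s0.
  pose A := c * D / (2 * (L * c) + 1).
  have k0 : 0 < 2 * (L * c) + 1 by lra.
  have A0 : 0 <= A by rewrite divr_ge0 ?mulr_ge0// ltW.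
  have mid : measurable_fun [set: S] (@id S) by exact: measurable_id.
  have gap : flow_gap rho0 id id (Ph M) (Ph M') s <= A * expR (lam * s).
    have [_ QM] := PM.
    apply: (flow_gronwall mid mid MPhi MPhi'
      (C := C) (Lc := 0) (K := c * D)) => //.
    + by move=> r v _; exact: QM.
    + move=> r y r0; rewrite mul0r add0r (le_trans (enorm_mulmx_norm _ _))//.
      rewrite sphere_enorm mulr1 -/c -mulrA ler_wpM2l//.
      by have := MM' r; rewrite (ger0_norm r0).
    + apply: Rintegral_le_cst.
        apply: integrable_dist; apply: measurableT_comp => //;
          exact: measurable_nmap.
      by move=> z; rewrite /dist /= Phi0 Phi0' subrr enorm0.
    + by rewrite lam3 /A divfK// gt_eqF.
  have W : (W1 (rhoM M s) (rhoM M' s) <=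
      (flow_gap rho0 id id (Ph M) (Ph M') s)%:E)%E.
    by apply: W1_le_dist => //; exact: measurable_nmap.
  rewrite (le_trans (norm_le_opnorm _))//.
  rewrite (le_trans (opnormB_le L_ge0 F_lip W))//.
  rewrite (le_trans (ler_wpM2l L_ge0 gap))// mulrA.
  rewrite ler_pM ?mulr_ge0 ?expR_ge0 ?invr_ge0 ?(ltW k0)//.
    by rewrite /A [leLHS]mulrA ler_pdivrMr//; lra.
  (* The image curve is constant at negative times, and the weight at [t] dominates the one at
     [clamp t]. *)
  rewrite ler_expR ler_wpM2l ?(ltW lam0)// /s /clamp ge_max normr_ge0.
  exact: ler_norm.
- by split => [t|t]; [exact: cvg_cst|exact: QF].
- by rewrite mulr_ge0.
- move=> t; rewrite (le_trans (ler_normB _ _))//.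
  have H1 := norm_F_le L_ge0 F_lip (rhoM (fun=> F rho0) (clamp t)).
  have H2 := norm_F_le L_ge0 F_lip rho0.
  apply: (@le_trans _ _ (2 * C)); first by rewrite mulr_natl mulr2n lerD.
  rewrite ler_peMr ?mulr_ge0// -expR0 ler_expR mulr_ge0// ltW//.
have [Phi0 MPhi] := HPh M (conj cM QM).
exists (Ph M) => //.
by rewrite -[X in is_flow X _]/(T M) TM.
Qed.

(** Distance 0 lies below every threshold of [W1_weak], so all C^1 integrals agree. *)
Lemma W1_eq0_measure_eq mu nu : W1 mu nu = 0%E -> measure_eq mu nu.
Proof.
move=> W0; apply: measure_separation => f g fg.
apply/eqP; rewrite -subr_eq0 -normr_le0; apply/ler_addgt0Pr => e e0.
have [dl dl0 H] := W1_weak (has_gradient_sphere fg) e0.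
by rewrite add0r; apply: H; rewrite W0 lte_fin.
Qed.

End MeanFieldFlow.

Theorem theorem2p4 (R : realType) (n : nat)
    (F : Psphere R n -> 'M[R]_n.+1) (L : R) (L_ge0 : 0 <= L)
    (F_lip : forall mu nu : Psphere R n,
      ((opnorm (F mu - F nu))%:E <= L%:E * W1 mu nu)%E) :
  [/\ has_sup (range (fun mu => opnorm (F mu))),
      forall rho0 : Psphere R n, exists rho : R -> Psphere R n,
        [/\ weak_solution F rho0 rho,
            forall rho' : R -> Psphere R n, weak_solution F rho0 rho' ->
              forall t : R, 0 <= t -> measure_eq (rho' t) (rho t) &
            exists Psi : R -> sphere R n -> sphere R n,
              [/\ char_flow F rho Psi,
                  forall Psi' : R -> sphere R n -> sphere R n,
                    char_flow F rho Psi' ->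
                    forall t : R, 0 <= t -> Psi' t = Psi t &
                  forall t : R, 0 <= t ->
                    measurable_fun [set: sphere R n] (Psi t) /\
                    forall A : set (sphere R n), measurable A ->
                      rho t A = pushforward rho0 (Psi t) A]] &
      forall (rho0 rho0' : Psphere R n) (rho rho' : R -> Psphere R n),
        weak_solution F rho0 rho -> weak_solution F rho0' rho' ->
        forall t : R, 0 <= t ->
          (W1 (rho t) (rho' t) <=
             (expR ((3 * CF F + L) * t))%:E * W1 rho0 rho0')%E].
Proof.
split; first exact: opnorm_has_sup_range L_ge0 F_lip.
- move=> rho0; have [Phi Phi0 MPhi] := mean_field_flow_exists L_ge0 F_lip rho0.
  pose rho t : Psphere R n := distribution rho0 (nmap (Phi t)).
  have wrho : weak_solution F rho0 rho.
    exact: (pushforward_weak_solution (rho := rho) Phi0 MPhi (fun=> erefl)).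
  exists rho; split => //.
    move=> rho' wrho' t t0; apply: W1_eq0_measure_eq.
    apply/eqP; rewrite eq_le W1_ge0 andbT.
    rewrite (le_trans (stability L_ge0 F_lip wrho' wrho t0))//.
    by rewrite W1_eq0 ?mule0.
  exists (fun t => nmap (Phi t)); split.
  - exact: char_flow_nmap.
  - move=> Psi' HPsi'.
    exact: char_flow_unique L_ge0 F_lip _ _ _ Phi0 MPhi HPsi'.
  - by move=> t t0; split => //; exact: measurable_nmap.
- move=> rho0 rho0' rho rho' wrho wrho' t t0.
  exact: stability.
Qed.
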